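(* Any language $L$ that is linear-space reducible to $L_{KG}$ is verified by a 2ADfA with bounded error $\epsilon$, moreover, the protocol achieves perfect completeness.
   Context: The Knapsack-game language is $L_{KG}=\{ S\, \forall(a_1,b_1)\, \exists(e_1,f_1)\, \cdots \, \forall(a_n,b_n)\, \exists(e_n,f_n) \}$, where $S$ and each $a_i,b_i,e_i,f_i$ are natural numbers given in binary, and for every $x\in \prod_{i=1}^{n}\{a_i,b_i\}$ there exists $y\in \prod_{i=1}^{n}\{e_i,f_i\}$ with $S=\sum_{i=1}^{n}(x_i+y_i)$. An affine state of an $m$-state affine register is a vector $v\in\mathbb{R}^m$ whose entries sum to $1$; affine operators are real matrices whose columns each sum to $1$; weighting observes basis state $e_j$ with probability $|v_j|/\|v\|_1$. A 2ADfA is a two-way deterministic finite automaton on the read-only input $¢ w\$$ (left end-marker ¢, right end-marker \$) equipped with finitely many affine registers (with rational transition matrices), each updated by an affine operator or weighted at each step, with the deterministic state and head move then depending on state, symbol and weighting outcomes; it halts upon entering an accepting or rejecting state. The 2ADfA is the verifier in an Arthur–Merlin proof system (public coins: deterministic states, head moves and weighting outcomes are revealed to the all-powerful prover). Verification with error $\epsilon<1/2$ (rational): some prover makes every $w\in L$ accepted with probability at least $1-\epsilon$, and for every $w\notin L$ and every prover, $w$ is rejected with probability at least $1-\epsilon$. Perfect completeness means every $w\in L$ is accepted with probability $1$. *)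

(* Defs.v *)
(* All probabilities are rational (rational matrices and
   initial vectors), so everything is computed in [rat]. *)
From HB Require Import structures.
From mathcomp Require Import all_boot all_order all_algebra.
Unset Printing Implicit Defensive.
Import Order.TTheory GRing.Theory Num.Theory.

(* Read-only input tape  ¢ w $ : position 0 is ¢, positions 1..|w| hold w,
   position |w|+1 is $.                                                 *)
Inductive tsym (S : Type) := LEnd | REnd | Sym of S.
Arguments LEnd {S}. Arguments REnd {S}. Arguments Sym {S}.

Definition tape_at {S : Type} (w : seq S) (i : nat) : tsym S :=
  match i with
  | 0 => LEnd
  | i'.+1 => match drop i' w with x :: _ => Sym x | [::] => REnd end
  end.

Inductive move := MLeft | MStay | MRight.

(* head move on the input tape ¢w$ (positions 0 .. bound); the head never
   leaves the end-markers *)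
Definition move_in (bound : nat) (m : move) (p : nat) : nat :=
  match m with MLeft => p.-1 | MStay => p | MRight => minn p.+1 bound end.

Definition move_work (m : move) (p : nat) : nat :=
  match m with MLeft => p.-1 | MStay => p | MRight => p.+1 end.

Inductive kgsym := K0 | K1 | KAll | KEx | KLp | KRp | KComma.

Definition bits (s : seq bool) : seq kgsym := map (fun b : bool => if b then K1 else K0) s.
(* most significant bit first *)
Definition bitval (s : seq bool) : nat := foldl (fun a (b : bool) => (a.*2 + b)%N) 0%N s.

Definition enc_block (blk : seq bool * seq bool * seq bool * seq bool) : seq kgsym :=
  let: (a, b, e, f) := blk in
  KAll :: KLp :: bits a ++ KComma :: bits b ++ KRp ::
  KEx :: KLp :: bits e ++ KComma :: bits f ++ [:: KRp].

Definition enc_KG (S : seq bool) (blks : seq (seq bool * seq bool * seq bool * seq bool)) :=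
  bits S ++ flatten (map enc_block blks).

(* for every x in prod {a_i,b_i} there is y in prod {e_i,f_i} with
   S = sum_i (x_i + y_i); x (resp. y) is given by a choice vector of bools *)
Definition KG_game (S : nat) (q : seq (nat * nat * nat * nat)) : Prop :=
  forall x : seq bool, size x = size q ->
  exists y : seq bool, size y = size q /\
    S = (\sum_(i < size q)
           let: (a, b, e, f) := nth (0, 0, 0, 0)%N q i in
           ((if nth false x i then b else a) + (if nth false y i then f else e)))%N.

Definition LKG (w : seq kgsym) : Prop :=
  exists (S : seq bool) (blks : seq (seq bool * seq bool * seq bool * seq bool)),
    S != [::] /\
    all (fun blk : seq bool * seq bool * seq bool * seq bool =>
           let: (a, b, e, f) := blk in
           [&& a != [::], b != [::], e != [::] & f != [::]]) blks /\
    w = enc_KG S blks /\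
    KG_game (bitval S)
      (map (fun blk : seq bool * seq bool * seq bool * seq bool =>
              let: (a, b, e, f) := blk in (bitval a, bitval b, bitval e, bitval f)) blks).

(* Linear-space reductions: deterministic Turing transducers with a
   read-only two-way input tape ¢w$, one work tape, and a write-only
   one-way output tape.                                                 *)
Record lstm (S D : Type) := LSTM {
  mQ : finType;
  mG : finType;
  mblank : mG;
  mq0 : mQ;
  mhalt : pred mQ;
  (* state, input symbol, work symbol  |->
     new state, written work symbol, input move, work move, output symbol *)
  mdelta : mQ -> tsym S -> mG -> mQ * mG * move * move * option D;
  mc : nat
}.

Arguments mQ {S D}. Arguments mG {S D}. Arguments mblank {S D}. Arguments mq0 {S D}.
Arguments mhalt {S D}. Arguments mdelta {S D}. Arguments mc {S D}.

Record tmconf (S D : Type) (M : lstm S D) := TMConf {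
  cq : mQ M; cip : nat; ctape : nat -> mG M; cwp : nat; cout : seq D }.

Arguments TMConf {S D M}. Arguments cq {S D M}. Arguments cip {S D M}.
Arguments ctape {S D M}. Arguments cwp {S D M}. Arguments cout {S D M}.

Definition tm_init (S D : Type) (M : lstm S D) : tmconf S D M :=
  TMConf (mq0 M) 0 (fun _ => mblank M) 0 [::].

Definition tm_step (S D : Type) (M : lstm S D) (w : seq S) (c : tmconf S D M) : tmconf S D M :=
  if mhalt M (cq c) then c else
  let: (q', a, mi, mw, od) := mdelta M (cq c) (tape_at w (cip c)) (ctape c (cwp c)) in
  TMConf q' (move_in (size w).+1 mi (cip c))
    (fun i => if i == cwp c then a else ctape c i)
    (move_work mw (cwp c))
    (cout c ++ (if od is Some d then [:: d] else [::])).

Definition tm_run (S D : Type) (M : lstm S D) (w : seq S) (t : nat) : tmconf S D M :=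
  iter t (tm_step S D M w) (tm_init S D M).

Definition computes_linspace (S D : Type) (M : lstm S D) (f : seq S -> seq D) : Prop :=
  forall w : seq S,
    (exists T, mhalt M (cq (tm_run S D M w T)) /\ cout (tm_run S D M w T) = f w) /\
    (forall t, (cwp (tm_run S D M w t) < mc M * (size w).+1)%N).

Definition lin_space_reducible {S D : Type} (L : seq S -> Prop) (L' : seq D -> Prop) : Prop :=
  exists (M : lstm S D) (f : seq S -> seq D),
    computes_linspace S D M f /\ forall w, L w <-> L' (f w).

Local Open Scope ring_scope.

Record verifier (S : finType) := Verifier {
  vQ : finType;
  vG : finType;                       (* prover-to-verifier communication alphabet *)
  vr : nat;                           (* number of affine registers *)
  vdim : 'I_vr -> nat;
  vinit : forall k : 'I_vr, 'cV[rat]_(vdim k);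
  vq0 : vQ;
  vacc : pred vQ;
  vrej : pred vQ;
  (* for each register: Some M = apply affine operator M, None = weighting *)
  vop : vQ -> tsym S -> vG -> forall k : 'I_vr, option 'M[rat]_(vdim k);
  (* next state and head move, depending on the weighting outcomes
     (outcome of register k: Some j if weighted with result e_j, else None) *)
  vtr : vQ -> tsym S -> vG -> ('I_vr -> option nat) -> vQ * move
}.

Arguments vQ {S}. Arguments vG {S}. Arguments vr {S}. Arguments vdim {S}.
Arguments vinit {S}. Arguments vq0 {S}. Arguments vacc {S}. Arguments vrej {S}.
Arguments vop {S}. Arguments vtr {S}.

Definition affine_vec (n : nat) (v : 'cV[rat]_n) : bool := \sum_i v i 0 == 1.
Definition affine_op (n : nat) (M : 'M[rat]_n) : bool := [forall j, \sum_i M i j == 1].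

Definition wf_verifier (S : finType) (V : verifier S) : Prop :=
  (forall k, affine_vec _ (vinit V k)) /\
  (forall q s g k M, vop V q s g k = Some M -> affine_op _ M) /\
  (forall q, ~~ (vacc V q && vrej V q)).

Definition outcome {S : finType} (V : verifier S) := 'I_(vr V) -> option nat.

(* all-powerful prover: sees the whole history (its messages and all
   weighting outcomes, from which states and head moves are determined) *)
Definition prover {S : finType} (V : verifier S) :=
  seq (vG V * outcome V) -> vG V.

Definition wprob (n : nat) (v : 'cV[rat]_n) (j : nat) : rat :=
  (\sum_(i < n | val i == j) `|v i 0|) / (\sum_(i < n) `|v i 0|).

Definition basis (n : nat) (j : nat) : 'cV[rat]_n := \col_(i < n) ((val i == j)%:R).

Definition upd (I : eqType) (T : Type) (f : I -> T) (k : I) (x : T) : I -> T :=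
  fun k' => if k' == k then x else f k'.

Definition outcomes (S : finType) (V : verifier S)
    (regs : forall k, 'cV[rat]_(vdim V k)) (ops : forall k, option 'M[rat]_(vdim V k))
    : seq (rat * outcome V) :=
  foldr (fun k acc =>
           if ops k is None then
             flatten [seq [seq (po.1 * wprob _ (regs k) j, upd _ _ po.2 k (Some j))
                          | j <- iota 0 (vdim V k)] | po <- acc]
           else acc)
        [:: (1, fun _ => None)] (enum 'I_(vr V)).

Definition new_regs (S : finType) (V : verifier S)
    (regs : forall k, 'cV[rat]_(vdim V k)) (ops : forall k, option 'M[rat]_(vdim V k))
    (o : outcome V) : forall k, 'cV[rat]_(vdim V k) :=
  fun k => match ops k with Some M => M *m regs k | None => basis _ (odflt 0%N (o k)) end.

Fixpoint hprob (S : finType) (V : verifier S) (w : seq S) (P : prover V)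
    (target : pred (vQ V)) (t : nat) (q : vQ V) (pos : nat)
    (regs : forall k, 'cV[rat]_(vdim V k)) (hist : seq (vG V * outcome V)) {struct t} : rat :=
  if vacc V q || vrej V q then (target q)%:R else
  match t with
  | 0 => 0
  | t'.+1 =>
      let s := tape_at w pos in
      let g := P hist in
      let ops := vop V q s g in
      \sum_(po <- outcomes S V regs ops)
        po.1 * hprob S V w P target t' (vtr V q s g po.2).1
                 (move_in (size w).+1 (vtr V q s g po.2).2 pos)
                 (new_regs S V regs ops po.2) (rcons hist (g, po.2))
  end.

(* the probability of halting in [target] (the limit of hprob as t grows)
   is at least p *)
Definition halt_prob_ge (S : finType) (V : verifier S) (w : seq S) (P : prover V)
    (target : pred (vQ V)) (p : rat) : Prop :=
  forall d : rat, 0 < d ->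
    exists t, p - d <= hprob S V w P target t (vq0 V) 0 (vinit V) [::].

Definition verifies {S : finType} (V : verifier S) (L : seq S -> Prop) (eps : rat) : Prop :=
  wf_verifier S V /\
  (forall w, L w -> exists P : prover V, halt_prob_ge S V w P (vacc V) (1 - eps)) /\
  (forall w, ~ L w -> forall P : prover V, halt_prob_ge S V w P (vrej V) (1 - eps)).

Definition perfect_completeness {S : finType} (V : verifier S) (L : seq S -> Prop) : Prop :=
  forall w, L w -> exists P : prover V, halt_prob_ge S V w P (vacc V) 1.

(* Main.v *)
Require Import Defs.
From HB Require Import structures.
From mathcomp Require Import all_boot all_order all_algebra.
From mathcomp Require Import boolp.
From mathcomp Require Import ring lra zify.

(* The verifier works in rounds, in which it makes two passes over the output of
   the reduction, simulating the Turing machine with the help of the prover.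
   A configuration is a word aligned with the input tape; its number in a suitable
   base is held in an affine register.  At every step the prover spells out the
   current configuration; the verifier compares its number with the one predicted
   by the previous step, while predicting the next one, which is linear in the
   letters once the scanned symbols are known.  The comparison puts
   (D / eps, - D / eps) in a register, where D is the difference: the weighting
   certainly observes the origin if D = 0, and does so with probability at most
   eps / 2 if D is a nonzero integer.

   In the first pass coins choose x, in the second one the prover chooses y, and
   S - sum x - sum y is tested against 0 in the same way.  If the test succeeds,
   the verifier accepts only with a probability exponentially small in the
   number of coins, and otherwise starts a new round.  If w is not in L, some x
   is bad and is drawn with a probability larger than that of acceptance by a
   factor of order 1 / eps, so that each round increases the guaranteed
   probability of rejection by a fixed amount as long as it is below 1 - eps. *)

Set Implicit Arguments.
Unset Strict Implicit.
Unset Printing Implicit Defensive.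
Import Order.TTheory GRing.Theory Num.Theory.
Local Open Scope ring_scope.

(** * Weighting *)

Lemma wprob_ge0 n (v : 'cV[rat]_n) j : 0 <= wprob n v j.
Proof. by rewrite /wprob divr_ge0 // sumr_ge0. Qed.

Lemma wprob_ord n (v : 'cV[rat]_n) (j : 'I_n) :
  wprob n v j = `|v j 0| / \sum_i `|v i 0|.
Proof. by rewrite /wprob (big_pred1 j). Qed.

Lemma sum_wprob n (v : 'cV[rat]_n) : affine_vec n v -> \sum_(j < n) wprob n v j = 1.
Proof.
move=> /eqP v1; under eq_bigr do rewrite wprob_ord.
rewrite -mulr_suml divff // gt_eqF //; apply: lt_le_trans ltr01 _.
by rewrite -[1]normr1 -v1 ler_norm_sum.
Qed.

(** * Planar affine registers *)

(* A register of dimension 3 holds a point of the plane, given by its barycentric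
   coordinates with respect to the triangle (1, 0), (0, 1), (0, 0). *)
Definition point := (rat * rat)%type.

Definition origin : point := (0, 0).

Definition vertex (j : nat) : point := ((j == 0%N)%:R, (j == 1%N)%:R).

Definition bary (p : point) : 'cV[rat]_3 :=
  \col_i nth 0 [:: p.1; p.2; 1 - p.1 - p.2] i.

Definition bary_mx (f : point -> point) : 'M[rat]_3 :=
  \matrix_(i, j) bary (f (vertex j)) i 0.

Definition affine_fun (f : point -> point) := forall x y,
  f (x, y) = (x * (f (1, 0)).1 + y * (f (0, 1)).1 + (1 - x - y) * (f (0, 0)).1,
              x * (f (1, 0)).2 + y * (f (0, 1)).2 + (1 - x - y) * (f (0, 0)).2).

Lemma affine_bary p : affine_vec 3 (bary p).
Proof. by apply/eqP; rewrite !big_ord_recl big_ord0 !mxE /=; ring. Qed.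

Lemma affine_bary_mx f : affine_op 3 (bary_mx f).
Proof.
apply/forallP=> j; under eq_bigr do rewrite mxE; exact: affine_bary.
Qed.

Lemma affine_fun_id : affine_fun id.
Proof. by move=> x y; congr pair => /=; ring. Qed.

Lemma mul_bary_mx f p : affine_fun f -> bary_mx f *m bary p = bary (f p).
Proof.
case: p => x y f_aff; apply/colP=> i; rewrite !mxE !big_ord_recl big_ord0 !mxE f_aff /=.
by case: i => -[|[|[|//]]] /= _; rewrite /vertex /=; ring.
Qed.

Lemma basis_bary j : (j < 3)%N -> basis 3 j = bary (vertex j).
Proof.
move=> lt_j; apply/colP=> i; rewrite !mxE /vertex.
by case: i => -[|[|[|//]]] ?; case: j lt_j => [|[|[|//]]] _ //=; rewrite ?subr0 ?subrr ?sub0r.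
Qed.

Definition origin_prob (p : point) : rat := wprob 3 (bary p) 2.

Section Mean.
Variable R : numDomainType.
Implicit Types q u v a : R.

Definition mean q u v : R := q * u + (1 - q) * v.

Lemma meanvv q v : mean q v v = v.
Proof. by rewrite /mean; ring. Qed.

Lemma mean1 u v : mean 1 u v = u.
Proof. by rewrite /mean; ring. Qed.

Lemma mean_le q u v a : 0 <= q <= 1 -> u <= a -> v <= a -> mean q u v <= a.
Proof.
move=> /andP[q0 q1] le_u le_v; rewrite -[a](meanvv q).
by apply: lerD; rewrite ler_wpM2l ?subr_ge0.
Qed.

Lemma le_mean q u v a : 0 <= q <= 1 -> a <= u -> a <= v -> a <= mean q u v.
Proof.
move=> /andP[q0 q1] le_u le_v; rewrite -[a](meanvv q).
by apply: lerD; rewrite ler_wpM2l ?subr_ge0.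
Qed.

End Mean.

Lemma sum_wprob_mean p u v :
  \sum_(j < 3) wprob 3 (bary p) j * (if j == 2 :> nat then u else v) =
  mean (origin_prob p) u v.
Proof.
have := sum_wprob (affine_bary p); rewrite /mean /origin_prob.
by rewrite !big_ord_recl !big_ord0 /= => <-; ring.
Qed.

Lemma origin_prob_ge0 p : 0 <= origin_prob p.
Proof. exact: wprob_ge0. Qed.

Lemma origin_prob_le1 p : origin_prob p <= 1.
Proof.
rewrite -(sum_wprob (affine_bary p)) (bigD1 (@Ordinal 3 2 isT)) //= lerDl.
by apply: sumr_ge0 => j _; exact: wprob_ge0.
Qed.

Lemma origin_prob01 p : 0 <= origin_prob p <= 1.
Proof. by rewrite origin_prob_ge0 origin_prob_le1. Qed.

Lemma origin_probE p :
  origin_prob p = `|1 - p.1 - p.2| / (`|p.1| + `|p.2| + `|1 - p.1 - p.2|).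
Proof.
rewrite /origin_prob (wprob_ord _ (@Ordinal 3 2 isT)) !big_ord_recl big_ord0 !mxE /=.
by rewrite addr0 addrA.
Qed.

Lemma origin_prob_opp x : origin_prob (x, - x) = (1 + 2 * `|x|)^-1.
Proof.
by rewrite origin_probE /= normrN opprK addrNK normr1 mul1r; congr _^-1; ring.
Qed.

(** * Affine programs *)

Lemma uniform_time (I : finType) (A : I -> nat -> Prop) :
  (forall i t t', (t <= t')%N -> A i t -> A i t') ->
  (forall i, exists t, A i t) -> exists t, forall i, A i t.
Proof.
move=> A_mono /fin_all_exists[time At]; exists (\max_i time i) => i.
exact: A_mono (leq_bigmax i) (At i).
Qed.

Lemma archimedean_climb (R : archiRealFieldType) (A : R -> Prop) (gain target : R) :
  0 < gain -> A 0 ->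
  (forall v, A v -> 0 <= v -> v < target -> A (v + gain)) -> exists2 v, target <= v & A v.
Proof.
move=> gain_gt0 A0 climb.
have multiple n : (exists2 v, target <= v & A v) \/ A (gain *+ n).
  elim: n => [|n [?|An]]; [by right|by left|].
  case: (lerP target (gain *+ n)) => [le_t|lt_t]; first by left; exists (gain *+ n).
  by right; rewrite mulrSr; apply: climb; rewrite ?mulrn_wge0 // ltW.
pose n := Num.bound `|target / gain|.
have le_n : target <= gain *+ n.
  rewrite -mulr_natl -ler_pdivrMr //; apply: le_trans (ler_norm _) _.
  by apply/ltW/archi_boundP/normr_ge0.
by have [//|?] := multiple n; exists (gain *+ n).
Qed.

Lemma halt_prob_geW (S : finType) (V : verifier S) w P target p p' : p' <= p ->
  halt_prob_ge S V w P target p -> halt_prob_ge S V w P target p'.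
Proof.
move=> le_p prob_p d /prob_p[t prob_ge]; exists t; apply: le_trans prob_ge.
by rewrite lerD2r.
Qed.

Section AffineProgram.
Variables (S Q G R : finType) (q0 : Q) (acc rej : pred Q).
Hypothesis acc_rej : forall q, ~~ (acc q && rej q).

(* [Weigh k qy qn] goes to [qy] if the weighting of register [k] observes the
   vertex [origin], and to [qn] otherwise. *)
Inductive instr := Apply of (R -> point -> point) & Q & move | Weigh of R & Q & Q.

Variable prog : Q -> tsym S -> G -> instr.
Hypothesis prog_affine : forall q s g k,
  if prog q s g is Apply f _ _ then affine_fun (f k) else True.

Definition program_verifier : verifier S :=
  @Verifier S Q G #|R| (fun=> 3) (fun=> bary origin) q0 acc rej
    (fun q s g k => match prog q s g with
                    | Apply f _ _ => Some (bary_mx (f (enum_val k)))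
                    | Weigh k' _ _ => if k == enum_rank k' then None else Some (bary_mx id)
                    end)
    (fun q s g o => match prog q s g with
                    | Apply _ q' m => (q', m)
                    | Weigh k qy qn => (if odflt 0%N (o (enum_rank k)) == 2 then qy else qn, MStay)
                    end).

Local Notation V := program_verifier.

Lemma wf_program_verifier : wf_verifier S V.
Proof.
split; first by move=> k; exact: affine_bary.
split; last exact: acc_rej.
move=> q s g k M /=; case: prog => [f ? ?|k' ? ?]; last case: eqP => // _.
all: by case=> <-; exact: affine_bary_mx.
Qed.

Record conf := Conf { state : Q; head_pos : nat; reg : R -> point }.

Definition init_conf : conf := Conf q0 0 (fun=> origin).

Definition halted c := acc (state c) || rej (state c).

Local Notation set_reg := (upd R point).

Definition columns (z : R -> point) (k : 'I_(vr V)) : 'cV[rat]_(vdim V k) :=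
  bary (z (enum_val k)).

Section Word.
Variable w : seq S.

Definition instr_at c g := prog (state c) (tape_at w (head_pos c)) g.

Definition applied c f q m : conf :=
  Conf q (move_in (size w).+1 m (head_pos c)) (fun k => f k (reg c k)).

Definition observed c k q j : conf := Conf q (head_pos c) (set_reg (reg c) k (vertex j)).

Definition next c g (o : outcome V) : conf :=
  match instr_at c g with
  | Apply f q m => applied c f q m
  | Weigh k qy qn =>
      let j := odflt 0%N (o (enum_rank k)) in observed c k (if j == 2 then qy else qn) j
  end.

Definition unweighed : outcome V := fun=> None.

Definition weighed k j : outcome V := upd _ _ unweighed (enum_rank k) (Some j).

Definition halt_prob (P : prover V) (target : pred Q) t c hist : rat :=
  hprob S V w P target t (state c) (head_pos c) (columns (reg c)) hist.

Lemma next_weighed c g k qy qn j : instr_at c g = Weigh k qy qn ->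
  next c g (weighed k j) = observed c k (if j == 2 then qy else qn) j.
Proof. by rewrite /next => ->; rewrite /weighed /upd eqxx. Qed.

Lemma next_apply c g o f q m : instr_at c g = Apply f q m -> next c g o = applied c f q m.
Proof. by rewrite /next => ->. Qed.

Local Notation ops_at c g := (vop V (state c) (tape_at w (head_pos c)) g).

Lemma outcomes_apply c g f q m : instr_at c g = Apply f q m ->
  outcomes S V (columns (reg c)) (ops_at c g) = [:: (1, unweighed)].
Proof. by rewrite /outcomes /= -/(instr_at c g) => ->; elim: (enum _) => //= k l ->. Qed.

Lemma outcomes_weigh c g k qy qn : instr_at c g = Weigh k qy qn ->
  outcomes S V (columns (reg c)) (ops_at c g) =
  [seq (1 * wprob 3 (bary (reg c k)) j, weighed k j) | j <- iota 0 3].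
Proof.
rewrite /outcomes /= -/(instr_at c g) => ->.
have : enum_rank k \in enum 'I_#|R| by rewrite mem_enum.
have := enum_uniq 'I_#|R|; elim: (enum _) => //= k' l IH /andP[k'_notin uniq_l].
rewrite in_cons eq_sym; case: eqP => [k'_k _|_ /= k_in]; last by rewrite IH.
rewrite {k'}k'_k in k'_notin *; rewrite /columns enum_rankK.
rewrite (_ : foldr _ _ _ = [:: (1, unweighed)]) //=.
elim: l k'_notin {IH uniq_l} => //= k1 l IH.
by rewrite in_cons eq_sym negb_or => /andP[/negPf -> /IH ->].
Qed.

Lemma new_regs_next c g o : (forall k j, o k = Some j -> j < 3)%N ->
  new_regs S V (columns (reg c)) (ops_at c g) o = columns (reg (next c g o)).
Proof.
move=> o_lt3; apply/functional_extensionality_dep => k.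
have := prog_affine (state c) (tape_at w (head_pos c)) g (enum_val k).
rewrite /new_regs /columns /next /instr_at /=.
case: (prog _ _ _) => [f q m|k' qy qn] f_aff /=; first exact: mul_bary_mx.
rewrite /upd (can2_eq (@enum_valK _) (@enum_rankK _)).
case: eqP => [->|_]; last by rewrite mul_bary_mx //; exact: affine_fun_id.
by rewrite basis_bary //; case o_k: (o _) => [j|//]; exact: o_lt3 o_k.
Qed.

Lemma halt_prob_halted P target t c hist :
  halted c -> halt_prob P target t c hist = (target (state c))%:R.
Proof. by rewrite /halt_prob /halted => c_halted; case: t => [|t] /=; rewrite c_halted. Qed.

Lemma halt_prob_apply P target t c hist f q m (g := P hist) :
  ~~ halted c -> instr_at c g = Apply f q m ->
  halt_prob P target t.+1 c hist =
  halt_prob P target t (next c g unweighed) (rcons hist (g, unweighed)).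
Proof.
move=> /negPf c_running instr_c; rewrite /halt_prob /= -/(halted c) c_running.
rewrite (outcomes_apply instr_c) big_seq1 /= mul1r new_regs_next //.
by rewrite /next /instr_at; case: prog.
Qed.

Lemma halt_prob_weigh P target t c hist k qy qn (g := P hist) :
  ~~ halted c -> instr_at c g = Weigh k qy qn ->
  halt_prob P target t.+1 c hist = \sum_(j < 3) wprob 3 (bary (reg c k)) j *
    halt_prob P target t (next c g (weighed k j)) (rcons hist (g, weighed k j)).
Proof.
move=> /negPf c_running instr_c; rewrite {1}/halt_prob /= -/(halted c) c_running.
rewrite (outcomes_weigh instr_c) big_map -[iota 0 3]val_enum_ord big_map big_enum.
apply: eq_bigr => j _; rewrite mul1r new_regs_next /=; last first.
  by move=> k' j'; rewrite /weighed /upd; case: eqP => // _ [<-].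
by rewrite /halt_prob /next -/(instr_at c g) instr_c.
Qed.

Lemma halt_prob_ge0 P target t c hist : 0 <= halt_prob P target t c hist.
Proof.
elim: t c hist => [|t IH] c hist; first by rewrite /halt_prob /=; case: ifP; rewrite ?ler0n.
have [c_halted|c_running] := boolP (halted c); first by rewrite halt_prob_halted.
case instr_c: (instr_at c (P hist)) => [f q m|k qy qn].
  by rewrite (halt_prob_apply _ _ _ instr_c).
by rewrite (halt_prob_weigh _ _ _ instr_c) // sumr_ge0 // => j _; rewrite mulr_ge0 ?wprob_ge0.
Qed.

Lemma halt_prob_leS P target t c hist :
  halt_prob P target t c hist <= halt_prob P target t.+1 c hist.
Proof.
elim: t c hist => [|t IH] c hist.
all: have [c_halted|c_running] := boolP (halted c); first by rewrite !halt_prob_halted.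
  by rewrite {1}/halt_prob /= -/(halted c) (negPf c_running) halt_prob_ge0.
case instr_c: (instr_at c (P hist)) => [f q m|k qy qn].
  by rewrite !(halt_prob_apply _ _ _ instr_c).
by rewrite !(halt_prob_weigh _ _ _ instr_c) // ler_sum // => j _; rewrite ler_wpM2l ?wprob_ge0.
Qed.

Lemma halt_prob_mono P target c hist :
  {homo (fun t => halt_prob P target t c hist) : t t' / (t <= t')%N >-> t <= t'}.
Proof. by apply: homo_leq => [//|? ? ?|t]; [exact: le_trans|exact: halt_prob_leS]. Qed.

Lemma halt_prob_weigh_ge P target t c hist k qy qn u v (g := P hist) :
  ~~ halted c -> instr_at c g = Weigh k qy qn ->
  (forall j : 'I_3, (if j == 2 :> nat then u else v) <=
     halt_prob P target t (next c g (weighed k j)) (rcons hist (g, weighed k j))) ->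
  mean (origin_prob (reg c k)) u v <= halt_prob P target t.+1 c hist.
Proof.
move=> c_running instr_c next_ge; rewrite (halt_prob_weigh _ _ _ instr_c) // -sum_wprob_mean.
by apply: ler_sum => j _; rewrite ler_wpM2l ?wprob_ge0.
Qed.

Definition rejection_ge (v : rat) c := exists t, forall P hist, v <= halt_prob P rej t c hist.

Lemma rejection_geW v v' c : v' <= v -> rejection_ge v c -> rejection_ge v' c.
Proof. by move=> le_v [t rej_v]; exists t => P hist; exact: le_trans le_v (rej_v _ _). Qed.

Lemma rejection_ge_le0 v c : v <= 0 -> rejection_ge v c.
Proof. by move=> v0; exists 0%N => P hist; exact: le_trans v0 (halt_prob_ge0 _ _ _ _ _). Qed.

Lemma rejection_ge_rej v c : rej (state c) -> v <= 1 -> rejection_ge v c.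
Proof.
by move=> c_rej v1; exists 0%N => P hist; rewrite halt_prob_halted ?c_rej // /halted c_rej orbT.
Qed.

Lemma rejection_ge_message v c :
  (forall g, exists t, forall P hist, P hist = g -> v <= halt_prob P rej t c hist) ->
  rejection_ge v c.
Proof.
move=> /uniform_time[|t rej_v]; last by exists t => P hist; exact: rej_v.
by move=> g t t' /halt_prob_mono le_t rej_v P hist /rej_v/le_trans; apply; exact: le_t.
Qed.

Lemma rejection_ge_apply v c : ~~ halted c ->
  (forall g, if instr_at c g is Apply f q m then rejection_ge v (applied c f q m) else False) ->
  rejection_ge v c.
Proof.
move=> c_running rej_next; apply: rejection_ge_message => g.
have := rej_next g; case instr_c: (instr_at c g) => [f q m|//] [t rej_v].
exists t.+1 => P hist P_g; rewrite -P_g in instr_c.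
by rewrite (halt_prob_apply _ _ _ instr_c) // (next_apply _ instr_c).
Qed.

Lemma rejection_ge_weigh u v v' c k qy qn : ~~ halted c ->
  (forall g, instr_at c g = Weigh k qy qn) ->
  rejection_ge u (observed c k qy 2) ->
  (forall j, (j < 2)%N -> rejection_ge v (observed c k qn j)) ->
  v' <= mean (origin_prob (reg c k)) u v -> rejection_ge v' c.
Proof.
move=> c_running instr_c rej_u rej_v /rejection_geW; apply.
have [t rej_uv] : exists t, forall j : 'I_3, forall P hist,
    (if j == 2 :> nat then u else v) <=
    halt_prob P rej t (observed c k (if j == 2 :> nat then qy else qn) j) hist.
  apply: uniform_time => [j t t' le_t ge_t P hist|[[|[|[|//]]] /= _]]; rewrite ?eqxx //.
  - exact: le_trans (ge_t P hist) (halt_prob_mono _ _ _ _ le_t).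
  - exact: rej_v.
  - exact: rej_v.
exists t.+1 => P hist; apply: halt_prob_weigh_ge => // j.
by rewrite (next_weighed _ (instr_c _)).
Qed.

Lemma rejection_ge_halt v P : rejection_ge v init_conf -> halt_prob_ge S V w P rej v.
Proof.
by move=> [t rej_v] d d_gt0; exists t; apply: le_trans (rej_v P [::]); rewrite gerBl ltW.
Qed.

(* Steps whose outcome depends neither on the messages nor on chance. *)
Record closed_under_forced (W : conf -> Prop) : Prop := ClosedUnderForced {
  forced_apply : forall c f q m, ~~ halted c -> (forall g, instr_at c g = Apply f q m) ->
    W (applied c f q m) -> W c;
  forced_weigh : forall c k qy qn, ~~ halted c -> (forall g, instr_at c g = Weigh k qy qn) ->
    origin_prob (reg c k) = 1 -> W (observed c k qy 2) -> W c }.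

Lemma closed_rejection_ge v : closed_under_forced (rejection_ge v).
Proof.
split=> [c f q m c_running instr_c rej_v|c k qy qn c_running instr_c sure rej_v].
  by apply: rejection_ge_apply => // g; rewrite instr_c.
apply: (rejection_ge_weigh (v := 0)) rej_v _ _ => // [j _|]; last by rewrite sure mean1.
exact: rejection_ge_le0.
Qed.

Section Honest.
Variable goal : pred conf.

Definition safe_next (W : pred conf) c g : bool :=
  match instr_at c g with
  | Apply f q m => W (applied c f q m)
  | Weigh k qy qn => W (observed c k qy 2) &&
      ((origin_prob (reg c k) < 1) ==> [forall j : 'I_2, W (observed c k qn j)])
  end.

Fixpoint reach n c : bool :=
  goal c || if n is n'.+1 then ~~ halted c && [exists g, safe_next (reach n') c g] else false.

Definition safe c := exists n, reach n c.

Lemma safe_nextW (W W' : pred conf) c g :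
  (forall c', W c' -> W' c') -> safe_next W c g -> safe_next W' c g.
Proof.
move=> WW'; rewrite /safe_next; case: instr_at => [f q m|k qy qn]; first exact: WW'.
case/andP=> /WW' -> /implyP W_other; apply/implyP=> /W_other/forallP W_j.
by apply/forallP=> j; exact: WW'.
Qed.

Lemma reach_mono n n' c : (n <= n')%N -> reach n c -> reach n' c.
Proof.
elim: n n' c => [|n IH] [|n'] c //= le_n; first by rewrite orbF => ->.
case/orP=> [->//|/andP[-> /existsP[g reach_g]]]; apply/orP; right; apply/existsP.
by exists g; apply: safe_nextW reach_g => c'; exact: IH.
Qed.

Lemma safe_goal c : goal c -> safe c.
Proof. by exists 0%N; rewrite /= orbF. Qed.

Lemma safe_message g c n : ~~ halted c -> safe_next (reach n) c g -> safe c.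
Proof.
move=> c_running safe_g; exists n.+1; rewrite /= c_running; apply/orP; right.
by apply/existsP; exists g.
Qed.

Lemma safe_apply g c : ~~ halted c ->
  (if instr_at c g is Apply f q m then safe (applied c f q m) else False) -> safe c.
Proof.
move=> c_running; case instr_c: (instr_at c g) => [f q m|//] [n reach_next].
by apply: (@safe_message g c n) => //; rewrite /safe_next instr_c.
Qed.

Lemma safe_weigh g c k qy qn : ~~ halted c -> instr_at c g = Weigh k qy qn ->
  safe (observed c k qy 2) ->
  (origin_prob (reg c k) < 1 -> forall j, (j < 2)%N -> safe (observed c k qn j)) ->
  safe c.
Proof.
move=> c_running instr_c [n0 reach_y] safe_n.
have [n1 reach_n] : exists n, forall j : 'I_2,
    (origin_prob (reg c k) < 1) ==> reach n (observed c k qn j).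
  apply: (@uniform_time _ (fun (j : 'I_2) n => (origin_prob (reg c k) < 1) ==>
    reach n (observed c k qn j))) => [j n n' le_n /implyP reach_j|j].
    by apply/implyP=> /reach_j; exact: reach_mono.
  case: (boolP (_ < 1)) => [lt1|_]; last by exists 0%N.
  by have [n reach_j] := safe_n lt1 j (ltn_ord j); exists n.
apply: (@safe_message g c (maxn n0 n1)) => //; rewrite /safe_next instr_c.
rewrite (reach_mono (leq_maxl _ _) reach_y) /=; apply/implyP=> lt1; apply/forallP=> j.
exact: reach_mono (leq_maxr _ _) (implyP (reach_n j) lt1).
Qed.

Lemma closed_safe (g : G) : closed_under_forced safe.
Proof.
split=> [c f q m c_running instr_c safe_c|c k qy qn c_running instr_c sure safe_c].
  by apply: (@safe_apply g) => //; rewrite instr_c.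
by apply: (safe_weigh (g := g)) safe_c _ => //; rewrite sure ltxx.
Qed.

Variables (g0 : G) (alpha : rat).
Hypothesis goal_retry : forall c, goal c -> ~~ halted c /\
  exists k qy qn, [/\ forall g, instr_at c g = Weigh k qy qn, acc qy,
    origin_prob (reg c k) = alpha &
    forall j, (j < 2)%N -> safe (observed c k qn j)].

(* A message that decreases the distance to [goal]. *)
Definition strategy c : G :=
  if pselect (safe c) is left c_safe then
    odflt g0 [pick g | safe_next (reach (ex_minn c_safe).-1) c g]
  else g0.

Lemma strategyP n c : reach n c -> ~~ goal c ->
  ~~ halted c /\ exists2 m, (m < n)%N & safe_next (reach m) c (strategy c).
Proof.
move=> reach_n not_goal; rewrite /strategy.
case: pselect => [c_safe|]; last by case; exists n.
case: ex_minnP => -[|m]; rewrite /= (negPf not_goal) // => /andP[-> /existsP[g safe_g]].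
move=> /(_ n reach_n) lt_m; split=> //; exists m => //.
by case: pickP => //= /(_ g); rewrite safe_g.
Qed.

Definition replay (hist : seq (G * outcome V)) : conf :=
  foldl (fun c go => next c go.1 go.2) init_conf hist.

Lemma replay_rcons hist g o : replay (rcons hist (g, o)) = next (replay hist) g o.
Proof. by rewrite /replay foldl_rcons. Qed.

Definition honest : prover V := fun hist => strategy (replay hist).

Definition safe_acceptance_ge (v : rat) := forall hist,
  safe (replay hist) -> exists t, v <= halt_prob honest acc t (replay hist) hist.

Lemma acceptance_ge_weigh hist k qy qn u v (c := replay hist) (g := honest hist) :
  ~~ halted c -> instr_at c g = Weigh k qy qn ->
  (forall j : 'I_3, (j == 2 :> nat) || (origin_prob (reg c k) < 1) ->
    exists t, (if j == 2 :> nat then u else v) <=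
      halt_prob honest acc t (next c g (weighed k j)) (rcons hist (g, weighed k j))) ->
  exists t, mean (origin_prob (reg c k)) u v <= halt_prob honest acc t c hist.
Proof.
move=> c_running instr_c prob_ge.
pose v' := if origin_prob (reg c k) < 1 then v else 0.
have [t prob_ge_t] : exists t, forall j : 'I_3, (if j == 2 :> nat then u else v') <=
    halt_prob honest acc t (next c g (weighed k j)) (rcons hist (g, weighed k j)).
  apply: uniform_time => [j t t' le_t ge_t|j].
    exact: le_trans ge_t (halt_prob_mono _ _ _ _ le_t).
  have := prob_ge j; rewrite {}/v'; case: (j == 2 :> nat) => /= [/(_ isT) //|].
  by case: ifP => [_ /(_ isT)//|_ _]; exists 0%N; exact: halt_prob_ge0.
exists t.+1; apply: le_trans (halt_prob_weigh_ge c_running instr_c prob_ge_t).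
rewrite /v'; case: ltP => // /(conj (origin_prob_le1 _))/andP/le_anti ->.
by rewrite !mean1.
Qed.

Lemma safe_acceptance_ge_mean v :
  v <= 1 -> safe_acceptance_ge v -> safe_acceptance_ge (mean alpha 1 v).
Proof.
move=> v1 v_accepted hist [n]; elim/ltn_ind: n hist => n IH hist reach_n.
have [is_goal|not_goal] := boolP (goal (replay hist)).
  have [c_running [k [qy [qn [instr_c qy_acc <- safe_qn]]]]] := goal_retry is_goal.
  apply: acceptance_ge_weigh (instr_c _) _ => // j _; rewrite -replay_rcons.
  have := ltn_ord j; rewrite ltnS leq_eqVlt; case: eqP => [j2 _|_ /= lt_j].
    exists 0%N; rewrite replay_rcons (next_weighed _ (instr_c _)) j2 eqxx.
    by rewrite halt_prob_halted /halted /= qy_acc.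
  apply: v_accepted; rewrite replay_rcons (next_weighed _ (instr_c _)) (ltn_eqF lt_j).
  exact: safe_qn.
have [c_running [m lt_m]] := strategyP reach_n not_goal.
rewrite -/(honest hist) /safe_next; case instr_c: instr_at => [f q mv|k qy qn].
  rewrite -(next_apply unweighed instr_c) -replay_rcons => /(IH m lt_m)[t prob_ge].
  by exists t.+1; rewrite (halt_prob_apply _ _ _ instr_c) // -replay_rcons.
case/andP=> reach_y /implyP reach_n'.
rewrite -[mean alpha 1 v](meanvv (origin_prob (reg (replay hist) k))).
apply: acceptance_ge_weigh (instr_c) _ => // j; rewrite if_same -replay_rcons => possible.
apply: (IH m) => //; rewrite replay_rcons (next_weighed _ instr_c).
have := ltn_ord j; rewrite ltnS leq_eqVlt; case: eqP possible => [-> //|_ lt1 /= lt_j].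
by have /forallP/(_ (Ordinal lt_j)) := reach_n' lt1.
Qed.

Lemma honest_accepts : 0 < alpha -> alpha <= 1 -> safe init_conf ->
  halt_prob_ge S V w honest acc 1.
Proof.
move=> alpha0 alpha1 safe_init d d0.
have [v le_v [_ v_accepted]] : exists2 v, 1 - d <= v & v <= 1 /\ safe_acceptance_ge v; last first.
  by have [t prob_ge] := v_accepted [::] safe_init; exists t; exact: le_trans le_v prob_ge.
apply: (archimedean_climb (A := fun v => v <= 1 /\ safe_acceptance_ge v) (gain := alpha * d)).
- exact: mulr_gt0.
- by split=> // hist _; exists 0%N; exact: halt_prob_ge0.
move=> v [v1 v_accepted] _ lt_v.
have gain_le : v + alpha * d <= mean alpha 1 v.
  have : alpha * d <= alpha * (1 - v) by rewrite ler_wpM2l ?(ltW alpha0) //; lra.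
  by rewrite /mean; lra.
split=> [|hist /(safe_acceptance_ge_mean v1 v_accepted)[t prob_ge]]; last first.
  by exists t; exact: le_trans gain_le prob_ge.
apply: le_trans gain_le _.
have : alpha * (1 - v) <= 1 * (1 - v) by rewrite ler_wpM2r // subr_ge0.
by rewrite /mean; lra.
Qed.

End Honest.
End Word.
End AffineProgram.

(** * The knapsack game as a run of a nondeterministic parser *)

(* [InPair ex snd ne]: inside the first or second ([snd]) number of a universal
   or existential ([ex]) pair, with at least one digit read if [ne]. *)
Inductive pstate :=
  AtStart | InTotal | AtPair of bool | InPair of bool & bool & bool | AtEx | AtAll | ParseError.

Definition pstate_code (p : pstate) : 'I_7 * (bool * bool * bool) :=
  match p with
  | AtStart => (inord 0, (false, false, false))
  | InTotal => (inord 1, (false, false, false))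
  | AtPair ex => (inord 2, (ex, false, false))
  | InPair ex snd ne => (inord 3, (ex, snd, ne))
  | AtEx => (inord 4, (false, false, false))
  | AtAll => (inord 5, (false, false, false))
  | ParseError => (inord 6, (false, false, false))
  end.

Definition pstate_decode (x : 'I_7 * (bool * bool * bool)) : pstate :=
  let: (i, (ex, snd, ne)) := x in
  nth ParseError [:: AtStart; InTotal; AtPair ex; InPair ex snd ne; AtEx; AtAll; ParseError] i.

Lemma pstate_codeK : cancel pstate_code pstate_decode.
Proof. by case=> *; rewrite /= inordK. Qed.

HB.instance Definition _ := Finite.copy pstate (can_type pstate_codeK).

Definition after_number (ex snd : bool) : pstate :=
  if snd then (if ex then AtAll else AtEx) else InPair ex true false.

Definition parse (p : pstate) (d : kgsym) : pstate :=
  match p, d with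
  | AtStart, K0 | AtStart, K1 | InTotal, K0 | InTotal, K1 => InTotal
  | InTotal, KAll | AtAll, KAll => AtPair false
  | AtEx, KEx => AtPair true
  | AtPair ex, KLp => InPair ex false false
  | InPair ex snd _, K0 | InPair ex snd _, K1 => InPair ex snd true
  | InPair ex snd ne, KComma => if ne && ~~ snd then after_number ex snd else ParseError
  | InPair ex snd ne, KRp => if ne && snd then after_number ex snd else ParseError
  | _, _ => ParseError
  end.

Definition complete (p : pstate) : bool := match p with InTotal | AtAll => true | _ => false end.

Definition parses (p : pstate) (o : seq kgsym) : bool := complete (foldl parse p o).

Definition block := (seq bool * seq bool * seq bool * seq bool)%type.

Definition wf_block (blk : block) :=
  let: (a, b, e, f) := blk in [&& a != [::], b != [::], e != [::] & f != [::]].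

Lemma enc_block_cat a b e f o : enc_block (a, b, e, f) ++ o =
  KAll :: KLp :: bits a ++ KComma :: bits b ++ KRp ::
  KEx :: KLp :: bits e ++ KComma :: bits f ++ KRp :: o.
Proof. by do !rewrite /= -catA. Qed.

Lemma parses_cons p d o : parses p (d :: o) = parses (parse p d) o.
Proof. by []. Qed.

Lemma parses_error o : parses ParseError o = false.
Proof. by elim: o. Qed.

Lemma parses_number ex snd ne o : parses (InPair ex snd ne) o ->
  exists a o', [/\ ne || (a != [::]), o = bits a ++ (if snd then KRp else KComma) :: o'
                 & parses (after_number ex snd) o'].
Proof.
elim: o ne => [//|d o IH] ne.
have digit b : parses (InPair ex snd true) o ->
    exists a o', [/\ ne || (a != [::]), (if b then K1 else K0) :: o =
      bits a ++ (if snd then KRp else KComma) :: o' & parses (after_number ex snd) o'].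
  by move=> /IH[a [o' [_ -> parses_o']]]; exists (b :: a), o'; rewrite orbT.
rewrite parses_cons; case: d; rewrite ?parses_error //.
- exact: (digit false).
- exact: (digit true).
- by case: ne snd {digit IH} => -[]; rewrite /= ?parses_error // => ?; exists [::], o.
- by case: ne snd {digit IH} => -[]; rewrite /= ?parses_error // => ?; exists [::], o.
Qed.

Lemma parses_pair ex o : parses (AtPair ex) o -> exists a b o',
  [/\ a != [::], b != [::], o = KLp :: bits a ++ KComma :: bits b ++ KRp :: o'
    & parses (after_number ex true) o'].
Proof.
case: o => [|d o] //; rewrite parses_cons; case: d; rewrite ?parses_error //.
case/parses_number=> a [o' [a_neq0 -> /parses_number[b [o'' [b_neq0 -> parses_o'']]]]].
by exists a, b, o''.
Qed.

Lemma parses_blocks o : parses AtAll o ->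
  exists2 blks, all wf_block blks & o = flatten (map enc_block blks).
Proof.
have [n] := ubnP (size o); elim: n o => // n IH [|d o] /=; first by exists [::].
rewrite ltnS => le_n; rewrite parses_cons; case: d; rewrite ?parses_error //.
case/parses_pair=> a [b [o' [a_neq0 b_neq0 def_o]]].
case: o' def_o => [|d o'] // def_o.
rewrite parses_cons; case: d def_o => def_o; rewrite ?parses_error //.
case/parses_pair=> e [f [o'' [e_neq0 f_neq0 def_o']]] /IH[|blks wf_blks def_o''].
  apply: leq_trans le_n; rewrite def_o def_o'; do !rewrite /= size_cat; rewrite /=; lia.
exists ((a, b, e, f) :: blks); first by rewrite /= a_neq0 b_neq0 e_neq0 f_neq0.
by rewrite def_o def_o' def_o'' -enc_block_cat.
Qed.

Lemma parses_total o : parses InTotal o ->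
  exists S o', o = bits S ++ o' /\ parses AtAll o'.
Proof.
elim: o => [|d o IH]; first by exists [::], [::].
rewrite parses_cons; case: d; rewrite ?parses_error //.
- by move=> /IH[S [o' [-> ?]]]; exists (false :: S), o'.
- by move=> /IH[S [o' [-> ?]]]; exists (true :: S), o'.
- by exists [::], (KAll :: o).
Qed.

Lemma parses_enc o : parses AtStart o ->
  exists S blks, [/\ S != [::], all wf_block blks & o = enc_KG S blks].
Proof.
case: o => [|d o] //; rewrite parses_cons; case: d; rewrite ?parses_error //.
all: case/parses_total=> S [o' [-> /parses_blocks[blks wf_blks ->]]].
- by exists (false :: S), blks.
- by exists (true :: S), blks.
Qed.

(* The pair (total, number being read): in the universal pass [m = false] the
   total is read off the input, and in both passes the chosen numbers of the
   pairs of the corresponding kind are subtracted from it. *)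
Definition pay (m : bool) (q : pstate * bool) (d : kgsym) (z : point) : point :=
  match q.1, d with
  | AtStart, K0 | InTotal, K0 => if m then z else (2 * z.1, z.2)
  | AtStart, K1 | InTotal, K1 => if m then z else (2 * z.1 + 1, z.2)
  | InPair _ _ _, K0 => (z.1, 2 * z.2)
  | InPair _ _ _, K1 => (z.1, 2 * z.2 + 1)
  | InPair ex snd _, KComma | InPair ex snd _, KRp =>
      if (ex == m) && (snd == q.2) then (z.1 - z.2, 0) else (z.1, 0)
  | _, _ => z
  end.

Lemma pay_affine m q d : affine_fun (pay m q d).
Proof.
move=> x y; case: q => p ch; rewrite /pay.
by case: p => [||ex|ex snd ne|||]; case: d => /=; do ?case: ifP => _; congr pair => /=; ring.
Qed.

(* Forgetting the choice at the end of a pair makes the state independent of it. *)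
Definition advance (c : bool) (d : kgsym) (q : pstate * bool) : pstate * bool :=
  (parse q.1 d, match d with KLp => c | KRp => false | _ => q.2 end).

Definition kgstate := (pstate * bool * point)%type.

Definition kgstart (total : rat) : kgstate := (AtStart, false, (total, 0)).

Definition kgstep (m c : bool) (d : kgsym) (x : kgstate) : kgstate :=
  (advance c d x.1, pay m x.1 d x.2).

Fixpoint kgrun (m : bool) (o : seq kgsym) (x y : kgstate) : Prop :=
  if o is d :: o' then exists c, kgrun m o' (kgstep m c d x) y else x = y.

Definition kgwin (x : kgstate) : bool := complete x.1.1 && (x.2.1 == 0).

Lemma kgrun_exists m o x : exists y, kgrun m o x y.
Proof.
by elim: o x => [|d o IH] x; [exists x|have [y run_y] := IH (kgstep m true d x); exists y, true].
Qed.

Lemma kgrun_parse m o x y : kgrun m o x y -> y.1.1 = foldl parse x.1.1 o.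
Proof. by elim: o x => [|d o IH] x /=; [move=> <-|case=> c /IH]. Qed.

Lemma kgrun_total_int m o x y : kgrun m o x y ->
  x.2.1 \is a Num.int -> x.2.2 \is a Num.int -> y.2.1 \is a Num.int.
Proof.
elim: o x => [|d o IH] [[p ch] [x1 x2]] /=; first by move=> <-.
case=> c /IH{}IH int1 int2; apply: IH; rewrite /kgstep /pay /=.
all: by case: p => [||ex|ex snd ne|||]; case: d => //=; do ?case: ifP => _ //=;
  rewrite ?rpredD ?rpredM ?rpredN ?rpred0 ?rpred1 ?rpred_nat.
Qed.

Lemma kgrun_cons m d o x y : (if d is KLp then False else True) ->
  kgrun m (d :: o) x y = kgrun m o (kgstep m false d x) y.
Proof.
move=> no_choice; have stepE c : kgstep m c d x = kgstep m false d x by case: d no_choice.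
by apply/propext; split=> [[c]|run_y]; [|exists false]; rewrite ?stepE.
Qed.

Lemma bitval_rcons a b : bitval (rcons a b) = ((bitval a).*2 + b)%N.
Proof. exact: foldl_rcons. Qed.

Lemma bits_rcons a b o : bits (rcons a b) ++ o = bits a ++ (if b then K1 else K0) :: o.
Proof. by rewrite /bits map_rcons cat_rcons. Qed.

Lemma kgrun_number m a o ex snd ch t y :
  kgrun m (bits a ++ o) (InPair ex snd false, ch, (t, 0)) y =
  kgrun m o (InPair ex snd (a != [::]), ch, (t, (bitval a)%:R)) y.
Proof.
elim/last_ind: a o => [//|a b IH] o; rewrite bits_rcons IH kgrun_cons; last by case: b.
congr kgrun; rewrite bitval_rcons -muln2 natrD natrM mulrC -(size_eq0 (rcons a b)) size_rcons.
by case: b; rewrite ?addr0.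
Qed.

Lemma kgrun_bits m a o t y : a != [::] ->
  kgrun m (bits a ++ o) (kgstart (if m then t else 0)) y =
  kgrun m o (InTotal, false, (if m then t else (bitval a)%:R, 0)) y.
Proof.
move=> a_neq0; transitivity (kgrun m o (if a == [::] then AtStart else InTotal, false,
    (if m then t else (bitval a)%:R, 0)) y); last by rewrite (negPf a_neq0).
elim/last_ind: a o {a_neq0} => [//|a b IH] o.
rewrite bits_rcons IH kgrun_cons; last by case: b.
congr kgrun; rewrite bitval_rcons -muln2 natrD natrM mulrC -(size_eq0 (rcons a b)) size_rcons.
by case: b; case: m {IH}; case: eqP; rewrite ?addr0.
Qed.

Lemma kgrun_pair m ex a b o ch t y : a != [::] -> b != [::] ->
  kgrun m (KLp :: bits a ++ KComma :: bits b ++ KRp :: o) (AtPair ex, ch, (t, 0)) y <->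
  exists c, kgrun m o (after_number ex true, false,
    (if ex == m then t - (bitval (if c then b else a))%:R else t, 0)) y.
Proof.
move=> a_neq0 b_neq0.
have runE c : kgrun m (bits a ++ KComma :: bits b ++ KRp :: o)
      (InPair ex false false, c, (t, 0)) y =
    kgrun m o (after_number ex true, false,
      (if ex == m then t - (bitval (if c then b else a))%:R else t, 0)) y.
  rewrite kgrun_number kgrun_cons // a_neq0.
  have -> : kgstep m false KComma (InPair ex false true, c, (t, (bitval a)%:R)) =
      (InPair ex true false, c, (if (ex == m) && ~~ c then t - (bitval a)%:R else t, 0)).
    by rewrite /kgstep /pay /=; case: c; case: (ex == m).
  rewrite kgrun_number kgrun_cons // b_neq0; congr kgrun.
  by rewrite /kgstep /pay /=; case: c; case: (ex == m).
by split=> -[c run_c]; exists c; move: run_c; rewrite -runE.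
Qed.

Definition stakes := (nat * nat * nat * nat)%type.

Definition stake (m c : bool) (s : stakes) : nat :=
  let: (a, b, e, f) := s in if m then (if c then f else e) else (if c then b else a).

Definition block_stakes (blk : block) : stakes :=
  let: (a, b, e, f) := blk in (bitval a, bitval b, bitval e, bitval f).

Definition total_stake (m : bool) (q : seq stakes) (cs : seq bool) : nat :=
  \sum_(i < size q) stake m (nth false cs i) (nth (0, 0, 0, 0)%N q i).

Lemma total_stake_cons m s q c cs :
  total_stake m (s :: q) (c :: cs) = (stake m c s + total_stake m q cs)%N.
Proof. by rewrite /total_stake big_ord_recl. Qed.

Lemma kgrun_block m blk o p t y : complete p -> wf_block blk ->
  kgrun m (enc_block blk ++ o) (p, false, (t, 0)) y <->
  exists c, kgrun m o (AtAll, false, (t - (stake m c (block_stakes blk))%:R, 0)) y.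
Proof.
case: blk => [[[a b] e] f] p_complete /and4P[a_neq0 b_neq0 e_neq0 f_neq0].
rewrite enc_block_cat kgrun_cons //.
have -> : kgstep m false KAll (p, false, (t, 0)) = (AtPair false, false, (t, 0)).
  by case: p p_complete.
split=> [/(kgrun_pair _ _ _ _ _ _ a_neq0 b_neq0)[c1]|[c run_y]].
  rewrite kgrun_cons // => /(kgrun_pair _ true _ _ _ _ e_neq0 f_neq0)[c2 run_y].
  by exists (if m then c2 else c1); case: m run_y; [case: c2|case: c1].
apply/(kgrun_pair _ _ _ _ _ _ a_neq0 b_neq0); exists c; rewrite kgrun_cons //.
by apply/(kgrun_pair _ true _ _ _ _ e_neq0 f_neq0); exists c; case: m run_y; case: c.
Qed.

Lemma kgrun_blocks m blks p t y : complete p -> all wf_block blks ->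
  kgrun m (flatten (map enc_block blks)) (p, false, (t, 0)) y <->
  exists2 cs, size cs = size blks &
    y = (if blks is [::] then p else AtAll, false,
         (t - (total_stake m (map block_stakes blks) cs)%:R, 0)).
Proof.
elim: blks p t => [|blk blks IH] p t p_complete /=.
  by rewrite /total_stake; split=> [<-|[cs _ ->]]; [exists [::]|]; rewrite // big_ord0 subr0.
move=> /andP[wf_blk wf_blks]; apply: iff_trans (kgrun_block _ _ _ _ p_complete wf_blk) _.
split=> [[c /(IH AtAll _ isT wf_blks)[cs size_cs ->]]|[[//|c cs] [size_cs] def_y]].
  exists (c :: cs); rewrite /= ?size_cs // total_stake_cons natrD opprD addrA.
  by case: (blks).
exists c; apply/(IH AtAll _ isT wf_blks); exists cs => //.
by rewrite def_y total_stake_cons natrD opprD addrA; case: (blks).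
Qed.

Lemma kgrun_enc m S blks t y : S != [::] -> all wf_block blks ->
  kgrun m (enc_KG S blks) (kgstart (if m then t else 0)) y <->
  exists2 cs, size cs = size blks &
    y = (if blks is [::] then InTotal else AtAll, false,
         ((if m then t else (bitval S)%:R) - (total_stake m (map block_stakes blks) cs)%:R, 0)).
Proof. by move=> S_neq0 wf_blks; rewrite /enc_KG kgrun_bits //; exact: kgrun_blocks. Qed.

Lemma KG_gameP S (q : seq stakes) : KG_game S q <->
  forall cs, size cs = size q -> exists2 ds, size ds = size q &
    S%:R - (total_stake false q cs)%:R - (total_stake true q ds)%:R = 0 :> rat.
Proof.
have payoffE cs ds : (\sum_(i < size q) let: (a, b, e, f) := nth (0, 0, 0, 0) q i in
      ((if nth false cs i then b else a) + (if nth false ds i then f else e)))%N =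
    (total_stake false q cs + total_stake true q ds)%N.
  by rewrite /total_stake -big_split /=; apply: eq_bigr => i _; case: nth => [[[a b] e] f].
split=> game cs /game.
  by case=> ds [size_ds ->]; exists ds; rewrite // payoffE natrD; ring.
case=> ds size_ds /eqP; rewrite -addrA -opprD -natrD subr_eq0 eqr_nat => /eqP ->.
by exists ds; rewrite payoffE.
Qed.

Lemma LKGP o : LKG o <-> forall x, kgrun false o (kgstart 0) x ->
  exists2 y, kgrun true o (kgstart x.2.1) y & kgwin y.
Proof.
split=> [[S [blks [S_neq0 [wf_blks [-> /KG_gameP game]]]]] x|game].
  case/(@kgrun_enc false _ _ 0 _ S_neq0 wf_blks)=> cs size_cs ->.
  have [|ds] := game cs; first by rewrite size_map.
  rewrite size_map => size_ds payoff0; eexists.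
    by apply/(@kgrun_enc true _ _ _ _ S_neq0 wf_blks); exists ds.
  by rewrite /kgwin /= payoff0 eqxx; case: (blks).
have [x run_x] := kgrun_exists false o (kgstart 0).
have [y run_y /andP[y_complete _]] := game x run_x.
have [S [blks [S_neq0 wf_blks def_o]]] : exists S blks,
    [/\ S != [::], all wf_block blks & o = enc_KG S blks].
  by apply: parses_enc; rewrite /parses -(kgrun_parse run_y).
exists S, blks; split=> //; split=> //; split=> //.
apply/KG_gameP => cs; rewrite size_map => size_cs.
have [|z run_z /andP[_ /eqP payoff0]] := game (if blks is [::] then InTotal else AtAll, false,
    ((bitval S)%:R - (total_stake false (map block_stakes blks) cs)%:R, 0)).
  by rewrite def_o; apply/(@kgrun_enc false _ _ 0) => //; exists cs.
move: run_z payoff0; rewrite def_o => /(@kgrun_enc true _ _ _ _ S_neq0 wf_blks)[ds size_ds ->].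
by exists ds.
Qed.

(** * Radix notation *)

Fixpoint radix (R : pzSemiRingType) (b : R) (f : nat -> R) k : R :=
  if k is k'.+1 then b * radix b f k' + f k' else 0.

Lemma natr_radix (R : pzSemiRingType) (b : nat) (f : nat -> nat) k :
  (radix b f k)%:R = radix b%:R (fun i => (f i)%:R) k :> R.
Proof. by elim: k => //= k IH; rewrite natrD natrM IH. Qed.

Lemma natr_radixS (R : pzSemiRingType) (b : nat) (f : nat -> nat) k :
  (radix b f k.+1)%:R = b%:R * (radix b f k)%:R + (f k)%:R :> R.
Proof. by rewrite !natr_radix. Qed.

Lemma radix_inj (b : nat) (f g : nat -> nat) k :
  (forall i, f i < b)%N -> (forall i, g i < b)%N ->
  radix b f k = radix b g k -> forall i, (i < k)%N -> f i = g i.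
Proof.
move=> f_lt g_lt; elim: k => //= k IH /(congr1 (edivn^~ b)).
rewrite !(mulrC b) !edivn_eq // => -[/IH eq_fg eq_k] i.
by rewrite ltnS leq_eqVlt => /predU1P[->|/eq_fg].
Qed.

Lemma eq_radix (R : pzSemiRingType) (b : R) f g k :
  (forall i, (i < k)%N -> f i = g i) -> radix b f k = radix b g k.
Proof.
by elim: k => //= k IH eq_fg; rewrite IH ?eq_fg // => i lt_i; exact: eq_fg (ltnW _).
Qed.

Lemma radixD (R : comPzSemiRingType) (b : R) f g k :
  radix b (fun i => f i + g i) k = radix b f k + radix b g k.
Proof. by elim: k => [|k IH] /=; rewrite ?addr0 // IH mulrDr addrACA. Qed.

Lemma radixZ (R : comPzSemiRingType) (b a : R) f k :
  radix b (fun i => a * f i) k = a * radix b f k.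
Proof. by elim: k => [|k IH] /=; rewrite ?mulr0 // IH mulrDr mulrCA. Qed.

Definition spike (R : pzSemiRingType) (p : nat) (a : R) (i : nat) : R := if p == i then a else 0.

Lemma radix_spike (R : comPzSemiRingType) (b a : R) p k :
  radix b (spike p a) k = if (p < k)%N then a * b ^+ (k.-1 - p) else 0.
Proof.
elim: k => //= k ->; rewrite /spike ltnS; case: (ltngtP p k) => [lt_pk|lt_kp|->].
- rewrite addr0 mulrCA -exprS; congr (_ * _ ^+ _); lia.
- by rewrite mulr0 addr0.
- by rewrite mulr0 add0r subnn mulr1.
Qed.

Lemma radix_spikeS (R : comPzSemiRingType) (b a : R) p k : (p.+1 < k)%N ->
  radix b (spike p.+1 (b * a)) k = radix b (spike p a) k.
Proof.
move=> lt_pk; rewrite !radix_spike lt_pk (ltnW lt_pk) (mulrC b) -mulrA -exprS.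
congr (_ * _ ^+ _); lia.
Qed.

Lemma radix_spikeV (F : fieldType) (b a : F) p k : b != 0 -> (p.+1 < k)%N ->
  radix b (spike p (b^-1 * a)) k = radix b (spike p.+1 a) k.
Proof. by move=> b_neq0 lt_pk; rewrite -(radix_spikeS _ _ lt_pk) mulVKf. Qed.

Arguments radix : simpl never.

(** * Configurations of linear-space transducers as numbers *)

Definition is_lend (S : Type) (s : tsym S) := if s is LEnd then true else false.
Definition is_rend (S : Type) (s : tsym S) := if s is REnd then true else false.

Lemma is_lend_tape (S : Type) (w : seq S) i : is_lend (tape_at w i) = (i == 0)%N.
Proof. by case: i => //= i; case: drop. Qed.

Lemma is_rend_tape (S : Type) (w : seq S) i : is_rend (tape_at w i) = (size w < i)%N.
Proof. by case: i => //= i; rewrite ltnS -subn_eq0 -size_drop; case: drop. Qed.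

Definition tsym_code (S : Type) (s : tsym S) : option (option S) :=
  match s with LEnd => None | REnd => Some None | Sym a => Some (Some a) end.

Definition tsym_decode (S : Type) (s : option (option S)) : tsym S :=
  match s with None => LEnd | Some None => REnd | Some (Some a) => Sym a end.

Lemma tsym_codeK (S : Type) : cancel (@tsym_code S) (@tsym_decode S).
Proof. by case. Qed.

HB.instance Definition _ (S : finType) := Finite.copy (tsym S) (can_type (@tsym_codeK S)).

Section Transducer.
Variables (S D : Type) (M : lstm S D).
Local Notation n := (mc M).

Record action := Action {
  to_state : mQ M; written : mG M; input_move : move; work_move : move; emitted : option D }.

Definition transition (q : mQ M) (sa : tsym S * mG M) : action :=
  let: (q', a, mi, mw, od) := mdelta M q sa.1 sa.2 in Action q' a mi mw od.

Definition scan (w : seq S) (C : tmconf S D M) : tsym S * mG M :=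
  (tape_at w (cip C), ctape C (cwp C)).

Definition output (w : seq S) (C : tmconf S D M) : option D :=
  emitted (transition (cq C) (scan w C)).

Lemma tm_stepE w (C : tmconf S D M) (r := transition (cq C) (scan w C)) : ~~ mhalt M (cq C) ->
  tm_step S D M w C =
  TMConf (to_state r) (move_in (size w).+1 (input_move r) (cip C))
    (fun i => if i == cwp C then written r else ctape C i)
    (move_work (work_move r) (cwp C))
    (cout C ++ if emitted r is Some d then [:: d] else [::]).
Proof.
move=> /negPf not_halted; rewrite /tm_step not_halted /r /transition /=.
by case: mdelta => [[[[]]]].
Qed.

Definition in_bounds (w : seq S) (C : tmconf S D M) : bool :=
  (cip C <= (size w).+1)%N && (cwp C < n * (size w).+1)%N.

(* What the configuration shows at a position of the input tape: the [mc M] work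
   cells stored there, the work head if it is on one of them, and whether the
   input head is there. *)
Record letter := Letter { cells : {ffun 'I_n -> mG M}; work_at : option 'I_n; input_at : bool }.

Definition letter_code (l : letter) := (cells l, work_at l, input_at l).
Definition letter_decode x : letter := let: (z, o, h) := x in Letter z o h.

Lemma letter_codeK : cancel letter_code letter_decode.
Proof. by case. Qed.

HB.instance Definition _ := Finite.copy letter (can_type letter_codeK).

Local Notation nb_cells := #|{: {ffun 'I_n -> mG M}}|.

Definition work_rank (o : option 'I_n) : nat := if o is Some j then j.+1 else 0%N.

Definition letter_rank (l : letter) : nat :=
  (enum_rank (cells l) + nb_cells * (work_rank (work_at l) + n.+1 * input_at l))%N.

Definition base : nat := (nb_cells * (n.+1).*2)%N.

Lemma work_rank_lt o : (work_rank o < n.+1)%N.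
Proof. by case: o => [j|] //=; rewrite ltnS ltn_ord. Qed.

Lemma base_gt0 : (0 < base)%N.
Proof.
by rewrite muln_gt0 double_gt0 andbT; apply/card_gt0P; exists [ffun=> mblank M].
Qed.

Lemma letter_rank_lt l : (letter_rank l < base)%N.
Proof.
case: l => [z o h]; apply: (@leq_trans (nb_cells * (work_rank o + n.+1 * h).+1)).
  by rewrite mulnS ltn_add2r.
by rewrite leq_mul2l; have := work_rank_lt o; case: h => /=; lia.
Qed.

Lemma letter_rank_inj : injective letter_rank.
Proof.
move=> [z o h] [z' o' h'] /(congr1 (edivn^~ nb_cells)); rewrite /letter_rank /=.
rewrite ![(_ + nb_cells * _)%N]addnC ![(nb_cells * _)%N]mulnC !edivn_eq //.
case=> /(congr1 (edivn^~ n.+1)); rewrite ![(_ + n.+1 * _)%N]addnC ![(n.+1 * _)%N]mulnC.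
rewrite !edivn_eq ?work_rank_lt // => -[eq_h eq_o] /val_inj/enum_rank_inj ->.
congr Letter; last by case: h h' eq_h => -[].
by case: o o' eq_o => [j|] [j'|] //= [/val_inj ->].
Qed.

Definition work_pos (p i : nat) : option 'I_n :=
  if (p %/ n == i)%N then insub (p %% n)%N else None.

Definition letter_of (C : tmconf S D M) (i : nat) : letter :=
  Letter [ffun j : 'I_n => ctape C (n * i + j)] (work_pos (cwp C) i) (cip C == i).

Definition init_letter (s : tsym S) : letter :=
  Letter [ffun=> mblank M] (if is_lend s then insub 0%N else None) (is_lend s).

Lemma letter_of_init w i : letter_of (tm_init S D M) i = init_letter (tape_at w i).
Proof.
by rewrite /letter_of /init_letter /work_pos /= is_lend_tape div0n mod0n ![0%N == i]eq_sym.
Qed.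

Definition conf_rank (C : tmconf S D M) : nat -> nat :=
  radix base (fun i => letter_rank (letter_of C i)).

Local Notation b := (base%:R : rat).

Definition input_shift (mi : move) (s : tsym S) : rat :=
  match mi with
  | MLeft => if is_lend s then 1 else b
  | MStay => 1
  | MRight => if is_rend s then 1 else b^-1
  end.

Definition work_shift (mw : move) (s : tsym S) (j : nat) : rat :=
  match mw with
  | MLeft => if (0 < j)%N then j%:R else if is_lend s then 1 else b * n%:R
  | MStay => j.+1%:R
  | MRight => if (j.+1 < n)%N then j.+2%:R else b^-1
  end.

Definition new_cells (l : letter) (a : mG M) : {ffun 'I_n -> mG M} :=
  if work_at l is Some j then [ffun j' => if j' == j then a else cells l j'] else cells l.

(* The contribution of the letter [l] to the number of the next configuration; a
   head leaving for a neighbouring position is accounted for by a factor [base]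
   or [1 / base]. *)
Definition letter_next (s : tsym S) (r : action) (l : letter) : rat :=
  (enum_rank (new_cells l (written r)))%:R +
  nb_cells%:R * ((if work_at l is Some j then work_shift (work_move r) s j else 0) +
                 n.+1%:R * (if input_at l then input_shift (input_move r) s else 0)).

Lemma base_neq0 : b != 0.
Proof. by rewrite pnatr_eq0 -lt0n base_gt0. Qed.

Section Step.
Variables (w : seq S) (C : tmconf S D M).
Hypothesis C_in_bounds : in_bounds w C.
Local Notation N := (size w).+2.

Let cip_le : (cip C <= (size w).+1)%N.
Proof. by case/andP: C_in_bounds. Qed.

Let cwp_lt : (cwp C < n * (size w).+1)%N.
Proof. by case/andP: C_in_bounds. Qed.

Lemma space_gt0 : (0 < n)%N.
Proof. by case: n cwp_lt. Qed.

Lemma work_posE p i :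
  work_pos p i = if (p %/ n)%N == i then Some (Ordinal (ltn_pmod p space_gt0)) else None.
Proof.
rewrite /work_pos; case: eqP => // _; rewrite (insubT (fun j => j < n)%N (ltn_pmod p space_gt0)).
by congr Some; apply: val_inj.
Qed.

Lemma new_cellsE a i :
  new_cells (letter_of C i) a =
  [ffun j : 'I_n => if (n * i + j == cwp C)%N then a else ctape C (n * i + j)].
Proof.
rewrite /new_cells /= work_posE; apply/ffunP=> j; rewrite [RHS]ffunE.
have j_mod : ((n * i + j) %/ n = i)%N /\ ((n * i + j) %% n = j)%N.
  by rewrite mulnC divnMDl ?space_gt0 // divn_small // addn0 modnMDl modn_small.
case: eqP => [def_i|neq_i]; rewrite !ffunE.
  congr (if _ then _ else _); apply/eqP/eqP => [->|def_j].
    by rewrite -def_i /= mulnC -divn_eq.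
  by apply: val_inj; rewrite /= -def_j j_mod.2.
by case: eqP => // def_j; case: neq_i; rewrite -def_j j_mod.1.
Qed.

Lemma radix_input_head mi :
  radix b (spike (cip C) (input_shift mi (tape_at w (cip C)))) N =
  radix b (spike (move_in (size w).+1 mi (cip C)) 1) N.
Proof.
case: mi => //=; rewrite ?is_lend_tape ?is_rend_tape.
  by case: (cip C) cip_le => [|p] //= lt_p; rewrite -(radix_spikeS b 1) // mulr1.
case: ltnP => [lt_p|le_p]; first by congr (radix _ (spike _ _)); lia.
by rewrite (minn_idPl _) // -(radix_spikeV 1 base_neq0) ?mulr1.
Qed.

Definition cell_spike (p : nat) : nat -> rat := spike (p %/ n) (p %% n).+1%:R.

Lemma cell_spikeE i j : (j < n)%N -> cell_spike (i * n + j) = spike i j.+1%:R.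
Proof.
move=> lt_j; rewrite /cell_spike divnMDl ?space_gt0 // divn_small //.
by rewrite addn0 modnMDl modn_small.
Qed.

Lemma radix_work_head mw :
  radix b (spike (cwp C %/ n) (work_shift mw (tape_at w (cwp C %/ n)) (cwp C %% n))) N =
  radix b (cell_spike (move_work mw (cwp C))) N.
Proof.
have lt_i : (cwp C %/ n < (size w).+1)%N by rewrite ltn_divLR ?space_gt0 // mulnC.
rewrite [in RHS](divn_eq (cwp C) n); have := ltn_pmod (cwp C) space_gt0.
move: (cwp C %/ n)%N (cwp C %% n)%N lt_i => i j lt_i lt_j.
case: mw => /=; rewrite ?is_lend_tape.
- case: j lt_j => [|j] lt_j /=; last by rewrite addnS cell_spikeE //; lia.
  case: i lt_i => [|i] lt_i; first by rewrite (@cell_spikeE 0 0).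
  have -> : ((i.+1 * n + 0).-1 = i * n + n.-1)%N by lia.
  by rewrite cell_spikeE prednK ?space_gt0 //= radix_spikeS // ltnW.
- by rewrite cell_spikeE.
case: ltnP => [lt_jS|le_n]; first by rewrite -addnS cell_spikeE.
have -> : ((i * n + j).+1 = i.+1 * n + 0)%N by lia.
by rewrite cell_spikeE ?space_gt0 // -(radix_spikeV 1 base_neq0) ?mulr1.
Qed.

Lemma radix_letter_next : ~~ mhalt M (cq C) ->
  radix b (fun i => letter_next (tape_at w i) (transition (cq C) (scan w C)) (letter_of C i)) N =
  (conf_rank (tm_step S D M w C) N)%:R.
Proof.
move=> /tm_stepE ->; rewrite /conf_rank natr_radix; set r := transition _ _.
rewrite /letter_next /letter_rank /= !radixD radixZ radixD radixZ.
transitivity (radix b (fun i => (enum_rank (new_cells (letter_of C i) (written r)))%:R) N +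
  nb_cells%:R * (radix b (cell_spike (move_work (work_move r) (cwp C))) N +
    n.+1%:R * radix b (spike (move_in (size w).+1 (input_move r) (cip C)) 1) N)).
  congr (_ + _ * (_ + _ * _)); rewrite -?radix_work_head -?radix_input_head.
    by apply: eq_radix => i _; rewrite /spike work_posE; case: eqP => [->|].
  by apply: eq_radix => i _; rewrite /spike; case: eqP => [->|].
rewrite -!radixZ -!radixD -!radixZ -!radixD; apply: eq_radix => i _.
rewrite new_cellsE natrD natrM natrD natrM; congr (_ + _ * (_ + _ * _)).
  by rewrite /cell_spike /spike work_posE; case: eqP.
by rewrite /spike; case: eqP.
Qed.

End Step.

(* The output is listed step by step, [None] standing for a silent step. *)
Inductive halts_with (w : seq S) : tmconf S D M -> seq (option D) -> Prop :=
| HaltsNow C : mhalt M (cq C) -> halts_with w C [::]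
| HaltsLater C os : ~~ mhalt M (cq C) -> in_bounds w C -> halts_with w (tm_step S D M w C) os ->
    halts_with w C (output w C :: os).

Lemma iter_halts_with w T (C : tmconf S D M) :
  mhalt M (cq (iter T (tm_step S D M w) C)) ->
  (forall t, in_bounds w (iter t (tm_step S D M w) C)) ->
  exists2 os, halts_with w C os & cout (iter T (tm_step S D M w) C) = cout C ++ pmap id os.
Proof.
elim: T C => [|T IH] C; first by exists [::]; [exact: HaltsNow|rewrite cats0].
have [C_halts _ _|C_runs] := boolP (mhalt M (cq C)).
  exists [::]; first exact: HaltsNow.
  by rewrite iter_fix ?cats0 // /tm_step C_halts.
rewrite iterSr => T_halts bounded; have [|os os_halts ->] := IH _ T_halts.
  by move=> t; rewrite -iterSr.
exists (output w C :: os); first exact: HaltsLater (bounded 0%N) os_halts.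
by rewrite tm_stepE //= -catA /output; case: emitted.
Qed.

Lemma cip_run w t : (cip (tm_run S D M w t) <= (size w).+1)%N.
Proof.
elim: t => [//|t]; rewrite /tm_run iterS; move: (iter _ _ _) => C le_cip.
have [C_halts|C_runs] := boolP (mhalt M (cq C)); first by rewrite /tm_step C_halts.
rewrite tm_stepE //=; case: input_move => //=; first exact: leq_trans (leq_pred _) le_cip.
exact: geq_minr.
Qed.

Lemma computes_halts_with f w : computes_linspace S D M f ->
  exists2 os, halts_with w (tm_init S D M) os & pmap id os = f w.
Proof.
case/(_ w)=> -[T [T_halts <-]] small_space.
have [|os os_halts ->] := iter_halts_with T_halts; last by exists os.
by move=> t; rewrite /in_bounds small_space andbT cip_run.
Qed.

End Transducer.

(** * The protocol *)

Inductive phase := Start | Init | Rewind | Step | Toss | Sweep | Scale | Check | Update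
  | Final | Lottery | Accept | Reject.

Definition phases :=
  [:: Start; Init; Rewind; Step; Toss; Sweep; Scale; Check; Update; Final; Lottery; Accept; Reject].

Definition phase_code (ph : phase) : 'I_13 :=
  inord match ph with
  | Start => 0 | Init => 1 | Rewind => 2 | Step => 3 | Toss => 4 | Sweep => 5 | Scale => 6
  | Check => 7 | Update => 8 | Final => 9 | Lottery => 10 | Accept => 11 | Reject => 12 end%N.

Lemma phase_codeK : cancel phase_code (fun i => nth Reject phases i).
Proof. by case; rewrite /= inordK. Qed.

HB.instance Definition _ := Finite.copy phase (can_type phase_codeK).

Inductive register := Checker of bool | Game | Prize | Coin.

Definition register_code (k : register) : option (option (option bool)) :=
  match k with
  | Coin => None | Prize => Some None | Game => Some (Some None)
  | Checker p => Some (Some (Some p)) end.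

Definition register_decode (o : option (option (option bool))) : register :=
  match o with
  | None => Coin | Some None => Prize | Some (Some None) => Game
  | Some (Some (Some p)) => Checker p end.

Lemma register_codeK : cancel register_code register_decode.
Proof. by case. Qed.

HB.instance Definition _ := Finite.copy register (can_type register_codeK).

(* [Checker p] serves to check the letters of the current configuration, and
   [Checker (~~ p)] to predict the next one; then they exchange their roles. *)
Definition by_register (T : Type) (p : bool) (check predict game prize coin : T)
    (k : register) : T :=
  match k with
  | Checker p' => if p' == p then check else predict
  | Game => game | Prize => prize | Coin => coin end.

Section ByRegister.
Variables (p : bool) (check predict game prize coin : point).
Local Notation z := (by_register p check predict game prize coin).
Local Notation set := (upd register point z).

Lemma by_register_apply (f1 f2 f3 f4 f5 : point -> point) :
  (fun k => by_register p f1 f2 f3 f4 f5 k (z k)) =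
  by_register p (f1 check) (f2 predict) (f3 game) (f4 prize) (f5 coin).
Proof. by apply/funext=> -[p'|||] //=; case: eqP. Qed.

Lemma by_register_swap : z = by_register (~~ p) predict check game prize coin.
Proof. by apply/funext=> -[p'|||] //=; case: p; case: p'. Qed.

Lemma set_checker x : set (Checker p) x = by_register p x predict game prize coin.
Proof. by apply/funext=> -[p'|||] //; rewrite /upd /=; case: p; case: p'. Qed.

Lemma set_game x : set Game x = by_register p check predict x prize coin.
Proof. by apply/funext=> -[p'|||]. Qed.

Lemma set_coin x : set Coin x = by_register p check predict game prize x.
Proof. by apply/funext=> -[p'|||]. Qed.

End ByRegister.

Lemma by_register_eta (p : bool) (z : register -> point) :
  z = by_register p (z (Checker p)) (z (Checker (~~ p))) (z Game) (z Prize) (z Coin).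
Proof. by apply/funext=> -[p'|||] //=; case: p; case: p'. Qed.

Lemma origin_prob_half : origin_prob (1 / 2, 0) = 1 / 2.
Proof. by rewrite origin_probE. Qed.

Section Protocol.
Variables (S : finType) (M : lstm S kgsym) (eps : rat).
Hypothesis eps_gt0 : 0 < eps.

Local Notation b := ((base M)%:R : rat).

Definition test_point (a : rat) : point := (a / eps, - (a / eps)).

Lemma double_test a : (2 * (test_point a).1, 2 * (test_point a).2) = test_point (2 * a).
Proof. by rewrite /test_point /=; congr pair; ring. Qed.

Lemma origin_prob_test0 : origin_prob (test_point 0) = 1.
Proof. by rewrite origin_prob_opp mul0r normr0 mulr0 addr0 invr1. Qed.

Lemma origin_prob_test_gt0 a : 0 < origin_prob (test_point a).
Proof. by rewrite origin_prob_opp invr_gt0 ltr_pwDl // mulr_ge0. Qed.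

Lemma origin_prob_test_le a : a != 0 -> origin_prob (test_point a) <= eps / (2 * `|a|).
Proof.
rewrite -normr_gt0 => a_gt0; rewrite origin_prob_opp normrM normfV (gtr0_norm eps_gt0).
rewrite -[leRHS]invf_div -mulrA; have : 0 < `|a| / eps by rewrite divr_gt0.
by move: (_ / eps) => r r_gt0; rewrite lef_pV2 ?posrE; lra.
Qed.

Lemma origin_prob_test_int a : a \is a Num.int -> a != 0 -> origin_prob (test_point a) <= eps / 2.
Proof.
move=> a_int a_neq0; apply: le_trans (origin_prob_test_le a_neq0) _.
have a_ge1 := norm_intr_ge1 a_int a_neq0.
by rewrite ler_pM2l // lef_pV2 ?posrE ?mulr_gt0 //; lra.
Qed.

Lemma test_bound_le1 : 1 - eps / 2 <= 1.
Proof. by rewrite gerBl divr_ge0 // ltW. Qed.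

Definition final_prize (k : nat) : rat := 2 ^+ k * (2 ^+ k * 2).

Lemma lottery_prob_le k :
  origin_prob (test_point (final_prize k)) <= eps / 4 * (2 ^+ k)^-1.
Proof.
have X_ge1 : 1 <= 2 ^+ k :> rat by rewrite exprn_ege1.
have X_gt0 := lt_le_trans ltr01 X_ge1.
have prize_gt0 : 0 < final_prize k by rewrite !mulr_gt0.
apply: le_trans (origin_prob_test_le _) _; first by rewrite gt_eqF.
rewrite gtr0_norm // -mulrA -invfM ler_pM2l // lef_pV2 ?posrE ?mulr_gt0 //.
have : 2 ^+ k * 2 <= final_prize k by rewrite ler_peMl // ltW // mulr_gt0.
by lra.
Qed.

(* [heard] is the last announcement of the symbols under the two heads, together
   with the choice for the next pair. *)
Record control := Control {
  phase_of : phase; pass : bool; parity : bool; machine : mQ M; game : pstate * bool;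
  heard : tsym S * mG M * bool }.

Definition control_code x := (phase_of x, pass x, parity x, machine x, game x, heard x).
Definition control_decode x : control :=
  let: (ph, m, p, q, y, h) := x in Control ph m p q y h.

Lemma control_codeK : cancel control_code control_decode.
Proof. by case. Qed.

HB.instance Definition _ := Finite.copy control (can_type control_codeK).

Definition message : finType := (tsym S * mG M * bool * letter M)%type.

Definition agrees (sa : tsym S * mG M) (s : tsym S) (l : letter M) : bool :=
  (input_at l ==> (s == sa.1)) && (if work_at l is Some j then cells l j == sa.2 else true).

Definition idle (k : register) (z : point) := z.

Definition prog (x : control) (s : tsym S) (g : message) : instr control register :=
  let: Control ph m p q y h := x in
  let goto ph' := Control ph' m p q y h in
  let r := transition q h.1 in
  match ph with
  | Start =>
      Apply (by_register p (fun=> origin) (fun=> origin) (fun=> origin) (fun=> test_point 2) id)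
        (Control Init false p (mq0 M) (AtStart, false) h) MStay
  | Init =>
      Apply (by_register p
               (fun z => (b * z.1 + (letter_rank (init_letter M s))%:R, z.2)) id id id id)
        (goto (if is_rend s then Rewind else Init)) (if is_rend s then MStay else MRight)
  | Rewind =>
      Apply idle (goto (if is_lend s then Step else Rewind)) (if is_lend s then MStay else MLeft)
  | Step =>
      if ~~ mhalt M q then
        Apply (by_register p id id id (fun z => (2 * z.1, 2 * z.2)) (fun=> (1 / 2, 0)))
          (Control Toss m p q y g.1) MStay
      else if m then
        Apply (by_register p id id (fun z => test_point z.1) id id)
          (goto (if complete y.1 then Final else Reject)) MStay
      else
        Apply (by_register p (fun=> origin) (fun=> origin) (fun z => (z.1, 0)) id id)
          (Control Init true p (mq0 M) (AtStart, false) h) MStay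
  | Toss => Weigh Coin (Control Sweep m p q y (h.1, if m then h.2 else true))
                       (Control Sweep m p q y (h.1, if m then h.2 else false))
  | Sweep =>
      Apply (by_register p (fun z => (z.1, b * z.2 + (letter_rank g.2)%:R))
               (fun z => (b * z.1 + letter_next s r g.2, z.2)) id id id)
        (goto (if agrees h.1 s g.2 then if is_rend s then Scale else Sweep else Reject))
        (if is_rend s then MStay else MRight)
  | Scale => Apply (by_register p (fun z => test_point (z.1 - z.2)) id id id id) (goto Check) MStay
  | Check => Weigh (Checker p) (goto Update) (goto Reject)
  | Update =>
      Apply (by_register p (fun=> origin) id (oapp (pay m y) id (emitted r)) id id)
        (Control Rewind m (~~ p) (to_state r)
           (oapp (fun d => advance h.2 d y) y (emitted r)) h) MStay
  | Final => Weigh Game (goto Lottery) (goto Reject)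
  | Lottery => Weigh Prize (goto Accept) (goto Start)
  | Accept | Reject => Apply idle x MStay
  end.

Lemma prog_affine x s g k : if prog x s g is Apply f _ _ then affine_fun (f k) else True.
Proof.
have affine_by p f1 f2 f3 f4 f5 : affine_fun f1 -> affine_fun f2 -> affine_fun f3 ->
    affine_fun f4 -> affine_fun f5 -> affine_fun (by_register p f1 f2 f3 f4 f5 k).
  by case: k => [p'|||] //=; case: ifP.
case: x => -[] m p q y h //=; do ?case: ifP => _ //; try exact: affine_fun_id.
all: apply: affine_by; try exact: affine_fun_id.
all: try by move=> x1 x2; rewrite /test_point /=; congr pair; ring.
by case: emitted => [d|]; [exact: pay_affine|exact: affine_fun_id].
Qed.

Definition accepting (x : control) : bool := if phase_of x is Accept then true else false.
Definition rejecting (x : control) : bool := if phase_of x is Reject then true else false.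

Definition start : control :=
  Control Start false false (mq0 M) (AtStart, false) (LEnd, mblank M, false).

Definition protocol : verifier S := program_verifier start accepting rejecting prog.

Lemma wf_protocol : wf_verifier S protocol.
Proof. by apply: wf_program_verifier; case=> -[]. Qed.

Variable w : seq S.
Local Notation N := (size w).+2.
Local Notation first_conf := (tm_init S kgsym M).
Local Notation next_conf := (tm_step S kgsym M w).
Local Notation conf := (conf control register).
Local Notation halted := (@halted control register accepting rejecting).
Local Notation closed :=
  (@closed_under_forced S control message register accepting rejecting prog w).
Local Notation rejection_ge :=
  (@rejection_ge S control message register start accepting rejecting prog w).

Lemma protocol_closed_rejection_ge v : closed (rejection_ge v).
Proof. exact: closed_rejection_ge prog_affine _ _. Qed.

(* The verifier is about to simulate a step of [M] from the configuration [C],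
   the game being in state [x] and the prize register equal to [test_point A]. *)
Definition at_step (W : conf -> Prop) m p (C : tmconf S kgsym M) (x : kgstate) (A : rat) : Prop :=
  forall h (coin : point), W (Conf (Control Step m p (cq C) x.1 h) 0
    (by_register p ((conf_rank C N)%:R, 0) origin x.2 (test_point A) coin)).

Definition at_halt (W : conf -> Prop) m (x : kgstate) (A : rat) : Prop :=
  forall p C, mhalt M (cq C) -> at_step W m p C x A.

Definition at_start (W : conf -> Prop) : Prop :=
  forall m p q y h z, W (Conf (Control Start m p q y h) 0 z).

(* Reached when the letters [ls 0], ..., [ls i.-1] have been received. *)
Definition swept m p (C : tmconf S kgsym M) (x : kgstate) (A : rat) h (coin : point)
    (ls : nat -> letter M) i : conf :=
  Conf (Control (if (i < N)%N then Sweep else Scale) m p (cq C) x.1 h) (minn i (size w).+1)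
    (by_register p
       ((conf_rank C N)%:R, (radix (base M) (fun j => letter_rank (ls j)) i)%:R)
       (radix b (fun j => letter_next (tape_at w j) (transition (cq C) h.1) (ls j)) i, 0)
       x.2 (test_point A) coin).

Lemma eq_swept m p C x A h coin ls ls' i : (forall j, (j < i)%N -> ls j = ls' j) ->
  swept m p C x A h coin ls i = swept m p C x A h coin ls' i.
Proof.
move=> eq_ls; rewrite /swept.
rewrite (@eq_radix _ _ _ (fun j => letter_rank (ls' j))) => [|j lt_j]; last by rewrite eq_ls.
congr (Conf _ _ (by_register _ _ (_, _) _ _ _)).
by apply: eq_radix => j lt_j; rewrite eq_ls.
Qed.

Lemma swept0 m p C x A h coin ls : swept m p C x A h coin ls 0 =
  Conf (Control Sweep m p (cq C) x.1 h) 0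
    (by_register p ((conf_rank C N)%:R, 0) origin x.2 (test_point A) coin).
Proof. by []. Qed.

Definition kgstep_opt (m c : bool) (od : option kgsym) (x : kgstate) : kgstate :=
  oapp (fun d => kgstep m c d x) x od.

Section Forced.
Variable W : conf -> Prop.
Hypothesis W_closed : closed W.

Lemma rewind_to_step m p q y h i z :
  W (Conf (Control Step m p q y h) 0 z) -> W (Conf (Control Rewind m p q y h) i z).
Proof.
move=> W_step; elim: i => [|i IH]; first by apply: (forced_apply W_closed).
by apply: (forced_apply W_closed) => //; rewrite /applied is_lend_tape; exact: IH.
Qed.

Lemma init_to_step m p y h predict game prize coin :
  W (Conf (Control Step m p (mq0 M) y h) 0
       (by_register p ((conf_rank first_conf N)%:R, 0) predict game prize coin)) ->
  W (Conf (Control Init m p (mq0 M) y h) 0 (by_register p origin predict game prize coin)).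
Proof.
move=> W_step.
pose z i := by_register p ((conf_rank first_conf i)%:R, 0) predict game prize coin.
suff W_init : forall i, (i < N)%N -> W (Conf (Control Init m p (mq0 M) y h) i (z i)).
  exact: (W_init 0%N).
have z_step i : (fun k => by_register p
    (fun z => (b * z.1 + (letter_rank (init_letter M (tape_at w i)))%:R, z.2))
    id id id id k (z i k)) = z i.+1.
  by rewrite by_register_apply -letter_of_init /= -natr_radixS.
move=> i; have [d] := ubnP (N - i); elim: d i => // d IH i le_d lt_i.
apply: (forced_apply W_closed) => //; rewrite /applied z_step is_rend_tape /=.
case: ltnP => [lt_wi|le_iw] /=; last by rewrite (minn_idPl _) //; apply: IH; lia.
by apply: rewind_to_step; rewrite (_ : i.+1 = N) //; lia.
Qed.

Lemma init_at_step m p t h coin A : at_step W m p first_conf (kgstart t) A ->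
  W (Conf (Control Init m p (mq0 M) (AtStart, false) h) 0
       (by_register p origin origin (t, 0) (test_point A) coin)).
Proof. by move=> W_step; apply: init_to_step; exact: W_step. Qed.

Lemma at_start_first_pass : (forall p, at_step W false p first_conf (kgstart 0) 2) -> at_start W.
Proof.
move=> W_step m p q y h z; apply: (forced_apply W_closed) => //; rewrite /applied /=.
rewrite [z](by_register_eta p) by_register_apply; exact: init_at_step.
Qed.

Lemma at_halt_second_pass x A :
  (forall p, at_step W true p first_conf (kgstart x.2.1) A) -> at_halt W false x A.
Proof.
move=> W_step p C C_halts h coin; apply: (forced_apply W_closed) => //=.
  by move=> g; rewrite /instr_at /= C_halts.
rewrite /applied by_register_apply; exact: init_at_step.
Qed.

Lemma at_halt_final_test x A :
  (forall p q h coin check predict,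
     W (Conf (Control (if complete x.1.1 then Final else Reject) true p q x.1 h) 0
          (by_register p check predict (test_point x.2.1) (test_point A) coin))) ->
  at_halt W true x A.
Proof.
move=> W_final p C C_halts h coin; apply: (forced_apply W_closed) => //=.
  by move=> g; rewrite /instr_at /= C_halts.
by rewrite /applied by_register_apply; exact: W_final.
Qed.

Lemma honest_sweep m p C x A c coin : ~~ mhalt M (cq C) -> in_bounds w C ->
  at_step W m (~~ p) (next_conf C) (kgstep_opt m c (output w C) x) A ->
  W (swept m p C x A (scan w C, c) coin (letter_of C) N).
Proof.
move=> C_runs C_bounds W_step; rewrite /swept ltnn radix_letter_next // (minn_idPr _) //.
rewrite -/(conf_rank C N).
apply: (forced_apply W_closed) => //; rewrite /applied by_register_apply subrr /=.
apply: (forced_weigh W_closed) => //=; first by rewrite eqxx origin_prob_test0.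
rewrite /observed /= set_checker.
apply: (forced_apply W_closed) => //; rewrite /applied by_register_apply /=; apply: rewind_to_step.
have := W_step (scan w C, c) coin; rewrite by_register_swap tm_stepE //=.
by rewrite /kgstep_opt /output; case: emitted.
Qed.

End Forced.

Lemma swept_next (W : conf -> Prop) m p C x A h coin ls i a : (i < N)%N ->
  agrees h.1 (tape_at w i) (ls i) ->
  W (swept m p C x A h coin ls i.+1) ->
  if instr_at prog w (swept m p C x A h coin ls i) (a, ls i) is Apply f q mv
  then W (applied w (swept m p C x A h coin ls i) f q mv) else False.
Proof.
move=> lt_i ls_agrees; have min_i : minn i (size w).+1 = i by exact/minn_idPl.
rewrite /instr_at /swept lt_i /= min_i ls_agrees /applied by_register_apply /=.
rewrite is_rend_tape; suff [-> ->] : (i.+1 < N)%N = ~~ (size w < i)%N /\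
    minn i.+1 (size w).+1 = move_in (size w).+1 (if (size w < i)%N then MStay else MRight) i.
  by rewrite if_neg -natr_radixS.
by case: (ltnP (size w) i) => /= ?; split; lia.
Qed.

Lemma agrees_scan C i : in_bounds w C -> agrees (scan w C) (tape_at w i) (letter_of C i).
Proof.
move=> C_bounds; rewrite /agrees /= (work_posE C_bounds); apply/andP; split.
  by apply/implyP=> /eqP ->.
by case: eqP => // <-; rewrite ffunE /= mulnC -divn_eq.
Qed.

Lemma agrees_scan_eq C sa : in_bounds w C ->
  (forall i, (i < N)%N -> agrees sa (tape_at w i) (letter_of C i)) -> sa = scan w C.
Proof.
move=> C_bounds sa_agrees; have /andP[cip_le cwp_lt] := C_bounds.
have /andP[/implyP/(_ (eqxx _))/eqP sa1 _] := sa_agrees (cip C) cip_le.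
have lt_i : (cwp C %/ mc M < N)%N.
  by rewrite ltn_divLR ?(space_gt0 C_bounds) // mulnC (leq_trans cwp_lt) // leq_mul2l leqnSn orbT.
have /andP[_] := sa_agrees _ lt_i; rewrite /= (work_posE C_bounds) eqxx ffunE /= mulnC -divn_eq.
by move/eqP=> sa2; rewrite [sa]surjective_pairing -sa1 -sa2.
Qed.

(** * Soundness *)

Lemma mismatch_rejection m p C x A h coin ls :
  conf_rank C N != radix (base M) (fun j => letter_rank (ls j)) N ->
  rejection_ge (1 - eps / 2) (swept m p C x A h coin ls N).
Proof.
set received := radix _ _ N => neq_rank.
have := @origin_prob_test_int ((conf_rank C N)%:R - received%:R).
rewrite subr_eq0 eqr_nat => /(_ (rpredB (natr_int _ _) (natr_int _ _)) neq_rank) test_le.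
rewrite /swept ltnn -/received; apply: (forced_apply (protocol_closed_rejection_ge _)) => //=.
rewrite /applied by_register_apply /=.
apply: (rejection_ge_weigh prog_affine (u := 0) (v := 1)) => //= [|j _|].
- by apply: rejection_ge_le0 => //; exact: prog_affine.
- exact: rejection_ge_rej.
- by rewrite eqxx /mean; lra.
Qed.

Lemma full_sweep_rejection (v : rat) m p C x A h coin ls :
  v <= 1 - eps / 2 -> in_bounds w C -> ~~ mhalt M (cq C) ->
  (forall j, (j < N)%N -> agrees h.1 (tape_at w j) (ls j)) ->
  at_step (rejection_ge v) m (~~ p) (next_conf C) (kgstep_opt m h.2 (output w C) x) A ->
  rejection_ge v (swept m p C x A h coin ls N).
Proof.
move=> le_v C_bounds C_runs ls_agrees rej_step.
have [/eqP eq_rank|neq_rank] :=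
  boolP (conf_rank C N == radix (base M) (fun j => letter_rank (ls j)) N); last first.
  exact: rejection_geW le_v (mismatch_rejection _ _ _ _ _ _ neq_rank).
have lsE j : (j < N)%N -> ls j = letter_of C j.
  move=> lt_j; apply/letter_rank_inj/esym.
  have rank_lt (ls' : nat -> letter M) k : (letter_rank (ls' k) < base M)%N := letter_rank_lt _.
  exact: (radix_inj (rank_lt (letter_of C)) (rank_lt ls) eq_rank lt_j).
have def_h : h = (scan w C, h.2).
  rewrite [LHS]surjective_pairing; congr pair; apply: agrees_scan_eq => // j lt_j.
  by rewrite -lsE ?ls_agrees.
rewrite (eq_swept _ _ _ _ _ _ _ lsE) def_h.
by apply: (honest_sweep (protocol_closed_rejection_ge v)).
Qed.

Lemma sweep_rejection (v : rat) m p C x A h coin ls i :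
  v <= 1 - eps / 2 -> in_bounds w C -> ~~ mhalt M (cq C) -> (i <= N)%N ->
  (forall j, (j < i)%N -> agrees h.1 (tape_at w j) (ls j)) ->
  at_step (rejection_ge v) m (~~ p) (next_conf C) (kgstep_opt m h.2 (output w C) x) A ->
  rejection_ge v (swept m p C x A h coin ls i).
Proof.
move=> le_v C_bounds C_runs + + rej_step.
have [d] := ubnP (N - i); elim: d ls i => // d IH ls i le_d.
rewrite leq_eqVlt => /predU1P[-> ls_agrees|lt_iN ls_agrees]; first exact: full_sweep_rejection.
apply: (rejection_ge_apply prog_affine) => [|[a l]]; first by rewrite /swept lt_iN.
pose ls' j := if j == i then l else ls j.
rewrite (@eq_swept _ _ _ _ _ _ _ _ ls') => [|j lt_j]; last by rewrite /ls' (ltn_eqF lt_j).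
have [l_agrees|l_disagrees] := boolP (agrees h.1 (tape_at w i) l); last first.
  have min_i : minn i (size w).+1 = i by exact/minn_idPl.
  rewrite /instr_at /swept lt_iN /= min_i (negPf l_disagrees).
  by apply: rejection_ge_rej => //; exact: le_trans le_v test_bound_le1.
have def_l : l = ls' i by rewrite /ls' eqxx.
rewrite {1}def_l; apply: swept_next; rewrite -?def_l //; apply: IH => // [|j]; first by lia.
by rewrite ltnS leq_eqVlt /ls'; case: eqP => [-> //|_ /= /ls_agrees].
Qed.

Lemma step_rejection (v : bool -> rat) m p C x A :
  in_bounds w C -> ~~ mhalt M (cq C) -> (forall c, v c <= 1 - eps / 2) ->
  (forall c c', at_step (rejection_ge (v c)) m (~~ p) (next_conf C)
     (kgstep_opt m (if m then c' else c) (output w C) x) (2 * A)) ->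
  at_step (rejection_ge (mean (1 / 2) (v true) (v false))) m p C x A.
Proof.
move=> C_bounds C_runs le_v rej_next h coin.
apply: (rejection_ge_apply prog_affine) => // -[a l].
rewrite /instr_at /= C_runs /applied by_register_apply double_test.
have rej_sweep c coin' : rejection_ge (v c)
    (Conf (Control Sweep m p (cq C) x.1 (a.1, if m then a.2 else c)) 0
       (by_register p ((conf_rank C N)%:R, 0) origin x.2 (test_point (2 * A)) coin')).
  by rewrite -(swept0 _ _ _ _ _ _ _ (letter_of C)); apply: sweep_rejection => //; exact: rej_next.
apply: (rejection_ge_weigh prog_affine (u := v true) (v := v false)) => [//|//||j _|].
- by rewrite /observed /= set_coin; exact: (rej_sweep true).
- by rewrite /observed /= set_coin; exact: (rej_sweep false).
- rewrite [reg _ _]/= origin_prob_half; exact: lexx.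
Qed.

Definition step_rule (W : conf -> Prop) m : Prop := forall p C x A,
  in_bounds w C -> ~~ mhalt M (cq C) ->
  (forall c, at_step W m (~~ p) (next_conf C) (kgstep_opt m c (output w C) x) (2 * A)) ->
  at_step W m p C x A.

Lemma step_rule_rejection (v : rat) m : v <= 1 - eps / 2 -> step_rule (rejection_ge v) m.
Proof.
move=> le_v p C x A C_bounds C_runs rej_next; rewrite -[v](meanvv (1 / 2)).
exact: (step_rejection (v := fun=> v)).
Qed.

Lemma kgrun_opt m c od os x y :
  kgrun m (pmap id os) (kgstep_opt m c od x) y -> kgrun m (pmap id (od :: os)) x y.
Proof. by case: od => [d|] //= run_y; exists c. Qed.

Lemma kgrun_opt_inv m od os x y :
  kgrun m (pmap id (od :: os)) x y -> exists c, kgrun m (pmap id os) (kgstep_opt m c od x) y.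
Proof. by case: od => [d|] //= run_y; exists true. Qed.

Lemma pass_all_runs W m C os : step_rule W m -> halts_with w C os -> forall p x A,
  (forall y, kgrun m (pmap id os) x y -> at_halt W m y (2 ^+ size os * A)) ->
  at_step W m p C x A.
Proof.
move=> W_step; elim=> {C os} [C C_halts|C os C_runs C_bounds _ IH] p x A W_halt.
  by rewrite -[A]mul1r; exact: W_halt.
apply: W_step => // c; apply: IH => y run_y; rewrite mulrA -exprSr.
exact: W_halt (kgrun_opt run_y).
Qed.

Lemma pass_bad_run (u v : rat) C os : u <= v -> v <= 1 - eps / 2 -> halts_with w C os ->
  forall p x A,
  (forall y, kgrun false (pmap id os) x y ->
     at_halt (rejection_ge u) false y (2 ^+ size os * A)) ->
  (exists2 y, kgrun false (pmap id os) x y &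
     at_halt (rejection_ge v) false y (2 ^+ size os * A)) ->
  at_step (rejection_ge (mean (2 ^+ size os)^-1 v u)) false p C x A.
Proof.
move=> le_uv le_v; elim=> {C os} [C C_halts|C os C_runs C_bounds os_halts IH] p x A rej_u.
  by case=> y <-; rewrite mul1r expr0 invr1 mean1; exact.
case=> y /kgrun_opt_inv[c0 run_y] rej_v; rewrite /= exprS invfM; set r := (2 ^+ size os)^-1.
have r01 : 0 <= r <= 1 by rewrite invr_ge0 exprn_ge0 //= invf_le1 ?exprn_gt0 // exprn_ege1.
pose value c := if c == c0 then mean r v u else u.
have -> : mean (2^-1 * r) v u = mean (1 / 2) (value true) (value false).
  by rewrite /value /mean; case: (c0) => /=; field.
apply: step_rejection => // [c|c _].
  rewrite /value; case: (c == c0); last exact: le_trans le_v.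
  by apply: mean_le => //; exact: le_trans le_v.
have rej_u' y' : kgrun false (pmap id os) (kgstep_opt false c (output w C) x) y' ->
    at_halt (rejection_ge u) false y' (2 ^+ size os * (2 * A)).
  by move=> /kgrun_opt/rej_u; rewrite /= exprSr mulrA.
rewrite /value; case: eqP => [def_c|_].
  by apply: IH => //; exists y; [rewrite def_c|move: rej_v; rewrite /= exprSr mulrA].
by apply: pass_all_runs os_halts _ _ _ _ => //; apply: step_rule_rejection; exact: le_trans le_v.
Qed.

Lemma losing_rejection x A : x.2.1 \is a Num.int -> ~~ kgwin x ->
  at_halt (rejection_ge (1 - eps / 2)) true x A.
Proof.
move=> x_int not_win.
apply: (at_halt_final_test (protocol_closed_rejection_ge _)) => p q h coin check predict.
have := not_win; rewrite /kgwin; case: (complete x.1.1) => /= [x_neq0|_]; last first.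
  by apply: rejection_ge_rej => //; exact: test_bound_le1.
apply: (rejection_ge_weigh prog_affine (u := 0) (v := 1)) => //= [|j _|].
- by apply: rejection_ge_le0 => //; exact: prog_affine.
- exact: rejection_ge_rej.
- by have := origin_prob_test_int x_int x_neq0; rewrite /mean; lra.
Qed.

Lemma lottery_rejection (v : rat) x A : 0 <= v <= 1 -> at_start (rejection_ge v) ->
  at_halt (rejection_ge (mean (origin_prob (test_point A)) 0 v)) true x A.
Proof.
move=> v01 rej_start; set u := mean _ 0 v.
have [v_ge0 v_le1] := andP v01.
have u_le1 : u <= 1 by apply: mean_le; rewrite ?origin_prob01.
apply: (at_halt_final_test (protocol_closed_rejection_ge _)) => p q h coin check predict.
case: (complete x.1.1); last exact: rejection_ge_rej.
apply: (rejection_ge_weigh prog_affine (u := u) (v := 1)) => //= [|j _|].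
- rewrite /observed /= set_game.
  apply: (rejection_ge_weigh prog_affine (u := 0) (v := v)) => //=.
    by apply: rejection_ge_le0 => //; exact: prog_affine.
  by move=> j _; exact: rej_start.
- exact: rejection_ge_rej.
- by apply: le_mean; rewrite ?origin_prob01.
Qed.

Lemma round_gain (q r v : rat) : 0 <= q <= eps / 4 * r -> 0 < r <= 1 -> 0 <= v < 1 - eps ->
  v + eps / 4 * r <= mean r (1 - eps / 2) (mean q 0 v).
Proof.
move=> /andP[q_ge0 q_le] /andP[r_gt0 r_le1] /andP[v_ge0 v_lt]; have eps0 := eps_gt0.
have qv_le : q * v <= q by rewrite ler_piMr //; lra.
have rqv_ge0 : 0 <= r * (q * v) by rewrite !mulr_ge0 // ltW.
have gain_bad : r * (eps / 2) <= r * (1 - eps / 2 - v) by rewrite ler_pM2l //; lra.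
by rewrite /mean; lra.
Qed.

Section Soundness.
Variable os : seq (option kgsym).
Hypothesis os_halts : halts_with w first_conf os.
Hypothesis bad : exists2 x, kgrun false (pmap id os) (kgstart 0) x &
  forall y, kgrun true (pmap id os) (kgstart x.2.1) y -> ~~ kgwin y.

Local Notation X := (2 ^+ size os : rat).

Lemma second_pass_rejection (u : rat) x : u <= 1 - eps / 2 ->
  (forall y, kgrun true (pmap id os) (kgstart x.2.1) y ->
     at_halt (rejection_ge u) true y (final_prize (size os))) ->
  at_halt (rejection_ge u) false x (X * 2).
Proof.
move=> le_u rej_halt; apply: (at_halt_second_pass (protocol_closed_rejection_ge _)) => p.
exact: (pass_all_runs (step_rule_rejection le_u) os_halts).
Qed.

Lemma round_rejection (v : rat) : at_start (rejection_ge v) -> 0 <= v < 1 - eps ->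
  at_start (rejection_ge (v + eps / 4 * X^-1)).
Proof.
move=> rej_start v_bounds; have eps0 := eps_gt0.
pose q := origin_prob (test_point (final_prize (size os))).
have gain : v + eps / 4 * X^-1 <= mean X^-1 (1 - eps / 2) (mean q 0 v).
  apply: round_gain => //; first by rewrite origin_prob_ge0 lottery_prob_le.
  by rewrite invr_gt0 exprn_gt0 //= invf_le1 ?exprn_gt0 // exprn_ege1.
have mean_le_v : mean q 0 v <= v.
  by apply: mean_le; rewrite ?origin_prob01 //; case/andP: v_bounds.
have mean_le_test : mean q 0 v <= 1 - eps / 2 by lra.
apply: at_start_first_pass (protocol_closed_rejection_ge _) _ => p h coin.
apply: (rejection_geW gain).
apply: (pass_bad_run (u := mean q 0 v) (v := 1 - eps / 2)) => // [x _|].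
  apply: second_pass_rejection => // y _; apply: lottery_rejection => //; lra.
have [x run_x losing] := bad; exists x => //; apply: second_pass_rejection => // y run_y.
apply: losing_rejection; last exact: losing.
exact: kgrun_total_int run_y (kgrun_total_int run_x _ _) _.
Qed.

Lemma protocol_sound P : halt_prob_ge S protocol w P rejecting (1 - eps).
Proof.
have [] := archimedean_climb (A := fun v => at_start (rejection_ge v)) (gain := eps / 4 * X^-1)
  (target := 1 - eps).
- by rewrite mulr_gt0 ?divr_gt0 ?invr_gt0 ?exprn_gt0.
- by move=> m p q y h z; apply: rejection_ge_le0 => //; exact: prog_affine.
- by move=> v rej_start v_ge0 v_lt; apply: round_rejection; rewrite // v_ge0.
move=> v le_v rej_start; apply: halt_prob_geW le_v _; apply: rejection_ge_halt.
exact: rej_start.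
Qed.

End Soundness.

(** * Completeness *)

Section Completeness.
Variable os : seq (option kgsym).
Hypothesis os_halts : halts_with w first_conf os.

Definition at_lottery : pred conf := fun c =>
  [&& if phase_of (state c) is Lottery then true else false, head_pos c == 0%N
    & reg c Prize == test_point (final_prize (size os))].

Local Notation safe := (@safe S control message register accepting rejecting prog w at_lottery).

Definition default_message : message := (LEnd, mblank M, false, init_letter M REnd).

Lemma protocol_closed_safe : closed safe.
Proof. exact: closed_safe default_message. Qed.

Lemma sweep_safe m p C x A c coin i :
  in_bounds w C -> ~~ mhalt M (cq C) -> (i <= N)%N ->
  at_step safe m (~~ p) (next_conf C) (kgstep_opt m c (output w C) x) A ->
  safe (swept m p C x A (scan w C, c) coin (letter_of C) i).
Proof.
move=> C_bounds C_runs + safe_next; have [d] := ubnP (N - i); elim: d i => // d IH i le_d.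
rewrite leq_eqVlt => /predU1P[->|lt_iN]; first by apply: (honest_sweep protocol_closed_safe).
apply: (safe_apply (g := (scan w C, c, letter_of C i))); first by rewrite /swept lt_iN.
by apply: swept_next => //; [exact: agrees_scan|apply: IH; lia].
Qed.

Lemma step_safe m p C x A c : in_bounds w C -> ~~ mhalt M (cq C) ->
  (forall c', at_step safe m (~~ p) (next_conf C)
     (kgstep_opt m (if m then c else c') (output w C) x) (2 * A)) ->
  at_step safe m p C x A.
Proof.
move=> C_bounds C_runs safe_next h coin.
apply: (safe_apply (g := (scan w C, c, init_letter M REnd))) => //.
rewrite /instr_at /= C_runs /applied by_register_apply double_test.
have safe_sweep c' coin' : safe
    (Conf (Control Sweep m p (cq C) x.1 (scan w C, if m then c else c')) 0
       (by_register p ((conf_rank C N)%:R, 0) origin x.2 (test_point (2 * A)) coin')).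
  by rewrite -(swept0 _ _ _ _ _ _ _ (letter_of C)); apply: sweep_safe => //; exact: safe_next.
apply: (safe_weigh (g := default_message)) => //= [|_ j _].
all: by rewrite /observed /= set_coin; exact: safe_sweep.
Qed.

Lemma pass_some_run C o x y A : halts_with w C o -> kgrun true (pmap id o) x y ->
  at_halt safe true y (2 ^+ size o * A) -> forall p, at_step safe true p C x A.
Proof.
move=> o_halts; elim: o_halts x A => {C o} [C C_halts|C o C_runs C_bounds _ IH] x A.
  by move=> <-; rewrite mul1r => safe_halt p; exact: safe_halt.
move=> /kgrun_opt_inv[c run_y] safe_halt p; apply: (step_safe (c := c)) => // _.
by apply: IH run_y _ _; move: safe_halt; rewrite /= exprSr mulrA.
Qed.

Lemma winning_safe x : kgwin x -> at_halt safe true x (final_prize (size os)).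
Proof.
case/andP=> x_complete /eqP x0.
apply: (at_halt_final_test protocol_closed_safe) => p q h coin check predict; rewrite x_complete x0.
apply: (forced_weigh protocol_closed_safe) => //=; first exact: origin_prob_test0.
by apply: safe_goal; rewrite /at_lottery /observed /= set_game /=.
Qed.

Hypothesis win : forall x, kgrun false (pmap id os) (kgstart 0) x ->
  exists2 y, kgrun true (pmap id os) (kgstart x.2.1) y & kgwin y.

Lemma start_safe : at_start safe.
Proof.
apply: (at_start_first_pass protocol_closed_safe) => p.
apply: (pass_all_runs _ os_halts) => [|x run_x].
  by move=> p' C x A C_bounds C_runs safe_next; exact: (step_safe (c := true)).
apply: (at_halt_second_pass protocol_closed_safe); have [y run_y y_wins] := win run_x.
exact: pass_some_run os_halts run_y (winning_safe y_wins).
Qed.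

Lemma at_lottery_retry c : at_lottery c -> ~~ halted c /\
  exists k qy qn, [/\ forall g, instr_at prog w c g = Weigh k qy qn, accepting qy,
    origin_prob (reg c k) = origin_prob (test_point (final_prize (size os))) &
    forall j, (j < 2)%N -> safe (observed c k qn j)].
Proof.
case: c => -[[] // m p q y h] i z /and3P[/= _ /eqP -> /eqP zP]; split=> //.
exists Prize, (Control Accept m p q y h), (Control Start m p q y h).
by split=> // [|j _]; [rewrite -zP|exact: start_safe].
Qed.

Lemma protocol_complete : exists P, halt_prob_ge S protocol w P accepting 1.
Proof.
exists (honest w at_lottery default_message).
have prize_gt0 := origin_prob_test_gt0 (final_prize (size os)).
apply: honest_accepts at_lottery_retry prize_gt0 (origin_prob_le1 _) _; first exact: prog_affine.
exact: start_safe.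
Qed.

End Completeness.
End Protocol.

Theorem theorem8 (S : finType) (L : seq S -> Prop) :
  lin_space_reducible L LKG ->
  forall eps : rat, 0 < eps -> eps < 1 / 2 ->
  exists V : verifier S, verifies V L eps /\ perfect_completeness V L.
Proof.
case=> M [f [f_computed L_LKG]] eps eps_gt0 _.
have perfect : perfect_completeness (protocol M eps) L.
  move=> w /L_LKG/LKGP win; have [os os_halts def_o] := computes_halts_with w f_computed.
  by apply: (protocol_complete eps_gt0 os_halts); rewrite def_o.
exists (protocol M eps); split=> //; split; first exact: wf_protocol.
split=> [w /perfect[P accepts]|w not_L].
  by exists P; apply: halt_prob_geW accepts; rewrite gerBl ltW.
have [os os_halts def_o] := computes_halts_with w f_computed.
apply: (protocol_sound eps_gt0 os_halts); rewrite def_o.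
apply: contrapT => no_bad; apply/not_L/L_LKG/LKGP => x run_x.
apply: contrapT => no_win; apply: no_bad; exists x => // y run_y.
by apply/negP => y_wins; apply: no_win; exists y.
Qed.
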